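(* There is an absolute constant $c>0$ such that the following holds. Let $M=(\mathcal{S},\mathcal{A},P,r,\gamma)$ be a discounted MDP, and let $\bar{P}$ be a transition kernel admitting a linear feature representation $\phi:\mathcal{S}\times\mathcal{A}\to\mathbb{R}^K$ with $\|P(\cdot|s,a)-\bar{P}(\cdot|s,a)\|_{TV}\le\xi$ for all $(s,a)$, for some $\xi\ge0$. Suppose $\phi$ satisfies the anchor-state assumption with anchor set $\mathcal{K}$ and convex coefficients $\lambda_k^{s,a}$. Let $\delta\in(0,1)$, $\epsilon\in(0,(1-\gamma)^{-1/2}]$ and $\epsilon_{\mathrm{PS}}\ge0$. Let $\widehat{M}$ be the empirical MDP built from $N$ samples per anchor pair drawn from the true kernel $P$, and let $\widehat{\pi}$ be an $\epsilon_{\mathrm{PS}}$-optimal policy for $\widehat{M}$. If $N\ge \frac{c\log(cK(1-\gamma)^{-1}\delta^{-1})}{(1-\gamma)^3\epsilon^2}$, then with probability larger than $1-\delta$, $$Q^{\widehat{\pi}}\ \ge\ Q^*-\epsilon-\frac{3\epsilon_{\mathrm{PS}}}{1-\gamma}-\frac{16\sqrt{\xi}}{(1-\gamma)^2}\quad\text{componentwise on }\mathcal{S}\times\mathcal{A}.$$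
   Context: A discounted MDP $M=(\mathcal{S},\mathcal{A},P,r,\gamma)$ has finite $\mathcal{S},\mathcal{A}$, transition distributions $P(\cdot|s,a)$, reward $r:\mathcal{S}\times\mathcal{A}\to[0,1]$, $\gamma\in(0,1)$. For a policy $\pi:\mathcal{S}\to\mathcal{A}$, $V^\pi(s)=\mathbb{E}[\sum_{t\ge0}\gamma^tr(s^t,\pi(s^t))\mid s^0=s]$ and $Q^\pi(s,a)=r(s,a)+\gamma\sum_{s'}P(s'|s,a)V^\pi(s')$. $V^*=\max_\pi V^\pi$ (attained by an optimal policy $\pi^*$), $Q^*=Q^{\pi^*}$. A kernel $\bar P$ admits linear feature representation $\phi$ if $\bar P(s'|s,a)=\sum_{k=1}^K\phi_k(s,a)\psi_k(s')$ for some functions $\psi_k:\mathcal{S}\to\mathbb{R}$. Anchor-state assumption: there is $\mathcal{K}=\{(s_k,a_k)\}_{k=1}^K$ and coefficients $\lambda_k^{s,a}\ge0$, $\sum_k\lambda_k^{s,a}=1$, with $\phi(s,a)=\sum_k\lambda_k^{s,a}\phi(s_k,a_k)$ for all $(s,a)$. Empirical MDP: for each $k$ draw $N$ i.i.d. samples from $P(\cdot|s_k,a_k)$ via a generative model (independently across $k$); $\widehat{P}_\mathcal{K}(s'|s_k,a_k)=\mathrm{count}(s_k,a_k,s')/N$; $\widehat{P}(s'|s,a)=\sum_k\lambda_k^{s,a}\widehat{P}_\mathcal{K}(s'|s_k,a_k)$; $\widehat{M}=(\mathcal{S},\mathcal{A},\widehat{P},r,\gamma)$, with value functions $\widehat{V}^\pi$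 and optimal value $\widehat{V}^*$. A policy $\widehat{\pi}$ (possibly depending on the samples) is $\epsilon_{\mathrm{PS}}$-optimal for $\widehat{M}$ if $\widehat{V}^{\widehat{\pi}}(s)\ge\widehat{V}^*(s)-\epsilon_{\mathrm{PS}}$ for all $s$. *)

(* Defs.v *)
From HB Require Import structures.
From mathcomp Require Import all_boot all_order all_algebra.
From mathcomp Require Import all_classical all_reals all_analysis.
Set Implicit Arguments. Unset Strict Implicit. Unset Printing Implicit Defensive.
Import Order.TTheory GRing.Theory Num.Theory.
Local Open Scope ring_scope.

Definition is_kernel (R : realType) (S A : finType) (P : S -> A -> S -> R) : Prop :=
  (forall s a s', 0 <= P s a s') /\ (forall s a, \sum_(s' : S) P s a s' = 1).

Definition policy (S A : finType) := {ffun S -> A}.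

Fixpoint state_dist (R : realType) (S A : finType) (P : S -> A -> S -> R)
  (pi : policy S A) (t : nat) (s : S) : S -> R :=
  match t with
  | 0 => fun s' => (s' == s)%:R
  | t'.+1 => fun s' =>
      \sum_(u : S) state_dist P pi t' s u * P u (pi u) s'
  end.

Definition Vpi (R : realType) (S A : finType) (P : S -> A -> S -> R)
  (r : S -> A -> R) (gamma : R) (pi : policy S A) (s : S) : R :=
  limn (fun T : nat => \sum_(t < T)
          gamma ^+ t * \sum_(s' : S) state_dist P pi t s s' * r s' (pi s')).

(* V^*(s) = max_pi V^pi(s) (values are >= 0 since r >= 0). *)
Definition Vstar (R : realType) (S A : finType) (P : S -> A -> S -> R)
  (r : S -> A -> R) (gamma : R) (s : S) : R :=
  \big[Num.max/0]_(pi : policy S A) Vpi P r gamma pi s.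

Definition Qpi (R : realType) (S A : finType) (P : S -> A -> S -> R)
  (r : S -> A -> R) (gamma : R) (pi : policy S A) (s : S) (a : A) : R :=
  r s a + gamma * \sum_(s' : S) P s a s' * Vpi P r gamma pi s'.

(* Q^* = Q^{pi^*} = r + gamma P V^*  (pi^* attains V^* at every state). *)
Definition Qstar (R : realType) (S A : finType) (P : S -> A -> S -> R)
  (r : S -> A -> R) (gamma : R) (s : S) (a : A) : R :=
  r s a + gamma * \sum_(s' : S) P s a s' * Vstar P r gamma s'.

Definition tv_dist (R : realType) (S : finType) (p q : S -> R) : R :=
  2^-1 * \sum_(s : S) `|p s - q s|.

Definition linear_repr (R : realType) (S A : finType) (K : nat)
  (Pbar : S -> A -> S -> R) (phi : S -> A -> 'I_K -> R) : Prop :=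
  exists psi : 'I_K -> S -> R,
    forall s a s', Pbar s a s' = \sum_(k < K) phi s a k * psi k s'.

Definition anchor_assumption (R : realType) (S A : finType) (K : nat)
  (phi : S -> A -> 'I_K -> R) (anchors : 'I_K -> S * A)
  (lam : S -> A -> 'I_K -> R) : Prop :=
  (forall s a k, 0 <= lam s a k) /\
  (forall s a, \sum_(k < K) lam s a k = 1) /\
  (forall s a j, phi s a j =
     \sum_(k < K) lam s a k * phi (anchors k).1 (anchors k).2 j).

(* A sample outcome: omega (k, i) is the i-th next state drawn from P(.|s_k,a_k). *)
Definition samples (S : finType) (K N : nat) := {ffun 'I_K * 'I_N -> S}.

Definition sample_prob (R : realType) (S A : finType) (K N : nat)
  (P : S -> A -> S -> R) (anchors : 'I_K -> S * A) (omega : samples S K N) : R :=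
  \prod_(i : 'I_K * 'I_N) P (anchors i.1).1 (anchors i.1).2 (omega i).

Definition prob_event (R : realType) (S A : finType) (K N : nat)
  (P : S -> A -> S -> R) (anchors : 'I_K -> S * A)
  (E : samples S K N -> Prop) : R :=
  \sum_(omega : samples S K N | `[< E omega >]) sample_prob P anchors omega.

Definition emp_anchor (R : realType) (S : finType) (K N : nat)
  (omega : samples S K N) (k : 'I_K) (s' : S) : R :=
  (#|[set i : 'I_N | omega (k, i) == s']|)%:R / N%:R.

Definition emp_kernel (R : realType) (S A : finType) (K N : nat)
  (lam : S -> A -> 'I_K -> R) (omega : samples S K N) : S -> A -> S -> R :=
  fun s a s' => \sum_(k < K) lam s a k * emp_anchor R omega k s'.

Definition eps_optimal (R : realType) (S A : finType) (P : S -> A -> S -> R)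
  (r : S -> A -> R) (gamma eps : R) (pi : policy S A) : Prop :=
  forall s, Vpi P r gamma pi s >= Vstar P r gamma s - eps.

(* Main.v *)
Require Import Defs.
From HB Require Import structures.
From mathcomp Require Import all_boot all_order all_algebra.
From mathcomp Require Import all_classical all_reals all_analysis.
From mathcomp Require Import ring lra.
Import Order.TTheory GRing.Theory Num.Theory.
Import numFieldNormedType.Exports.
Local Open Scope ring_scope.

(* Write H = 1/(1-gamma). By linearity and the anchor condition, the mean
   P~ = sum_k lam_k P(.|s_k,a_k) of the empirical kernel P^ is within O(xi) of P in l1,
   and replacing P by P~ costs O(xi H^2) in value, so it remains to compare P^ with P~.
   Let V and U be the optimal values of P~ and P^, and W the value of pihat under P~.

   The gaps V - U and U - W are controlled by a maximum principle: if
   h <= gamma P h + b then h <= b H. Adding 2 t V^2 (resp. a multiple of U^2) to the gap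
   absorbs a Bernstein error t Var(V) + L/(N t) at a single fixed t ~ eps/H^2, because
   gamma Var_P(V) <= gamma P V^2 - (gamma P V)^2; this yields the rate H^3/eps^2.
   For V - U one needs the sampling errors of the deterministic functions V and V^2; for
   U - W one needs that of U, which depends on the samples. Freezing the expectation of U
   under the k-th empirical anchor to a scalar w gives a Bellman operator independent of
   these samples, and U is its fixed point for the right w. A crude bound on U - V
   confines w to an interval of length O(eps H), covered by O(H^3) grid points of step
   ~ eps/H^2, so the union bound costs only a logarithm of H, not of 1/eps. *)

(** * Averages and variances *)

Definition is_dist {R : realType} {S : finType} (p : S -> R) : Prop :=
  (forall s, 0 <= p s) /\ \sum_(s : S) p s = 1.

Definition avg {R : realType} {S : finType} (p f : S -> R) : R :=
  \sum_(s : S) p s * f s.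

Definition var {R : realType} {S : finType} (p f : S -> R) : R :=
  avg p (fun s => (f s - avg p f) ^+ 2).

Section Averages.
Context {R : realType} {S : finType}.
Implicit Types (p q f g : S -> R).

Lemma avgD p f g : avg p (fun s => f s + g s) = avg p f + avg p g.
Proof. by rewrite /avg -big_split; apply: eq_bigr => s _; rewrite mulrDr. Qed.

Lemma avgZ p c f : avg p (fun s => c * f s) = c * avg p f.
Proof. by rewrite /avg big_distrr; apply: eq_bigr => s _; rewrite mulrCA. Qed.

Lemma avgB p f g : avg p (fun s => f s - g s) = avg p f - avg p g.
Proof. by rewrite /avg -sumrB; apply: eq_bigr => s _; rewrite mulrBr. Qed.

Lemma avg_ext p f g : f =1 g -> avg p f = avg p g.
Proof. by move=> fg; apply: eq_bigr => s _; rewrite fg. Qed.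

Lemma var_ext p f g : f =1 g -> var p f = var p g.
Proof. by move=> fg; apply: avg_ext => s; rewrite fg (avg_ext p f g). Qed.

Lemma avg_cst p c : is_dist p -> avg p (fun=> c) = c.
Proof. by case=> _ p1; rewrite /avg -big_distrl /= p1 mul1r. Qed.

Lemma le_avg p f g : is_dist p -> (forall s, f s <= g s) -> avg p f <= avg p g.
Proof. by case=> p0 _ fg; apply: ler_sum => s _; apply: ler_wpM2l. Qed.

Lemma avg_le p f c : is_dist p -> (forall s, f s <= c) -> avg p f <= c.
Proof. by move=> pp fc; rewrite -[leRHS](avg_cst p c pp); apply: le_avg. Qed.

Lemma avg_ge p f c : is_dist p -> (forall s, c <= f s) -> c <= avg p f.
Proof. by move=> pp fc; rewrite -[leLHS](avg_cst p c pp); apply: le_avg. Qed.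

Lemma avg_norm_le p f c : is_dist p -> (forall s, `|f s| <= c) -> `|avg p f| <= c.
Proof.
move=> pp fc; rewrite ler_norml; apply/andP; split.
  by apply: avg_ge => // s; move: (fc s); rewrite ler_norml => /andP[].
by apply: avg_le => // s; move: (fc s); rewrite ler_norml => /andP[].
Qed.

Lemma sqr_le_sqr (x y : R) : 0 <= x -> x <= y -> x ^+ 2 <= y ^+ 2.
Proof. by move=> x0 xy; rewrite ler_sqr ?nnegrE //; apply: le_trans xy. Qed.

Lemma sqr_norm_le (x y : R) : `|x| <= y -> x ^+ 2 <= y ^+ 2.
Proof. by move=> xy; rewrite -(real_normK (num_real x)); apply: sqr_le_sqr. Qed.

Lemma avg_sqr_center p f c : is_dist p ->
  avg p (fun s => (f s - c) ^+ 2) =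
  avg p (fun s => f s ^+ 2) - 2 * c * avg p f + c ^+ 2.
Proof.
move=> pp; rewrite -(avgZ p (2 * c)) -[X in _ + X](avg_cst p _ pp) -avgB -avgD.
by apply: avg_ext => s; ring.
Qed.

Lemma varE p f : is_dist p -> var p f = avg p (fun s => f s ^+ 2) - avg p f ^+ 2.
Proof. by move=> pp; rewrite /var avg_sqr_center //; ring. Qed.

Lemma var_ge0 p f : is_dist p -> 0 <= var p f.
Proof. by move=> pp; apply: avg_ge => // s; apply: sqr_ge0. Qed.

Lemma sqr_avg_le p f : is_dist p -> avg p f ^+ 2 <= avg p (fun s => f s ^+ 2).
Proof. by move=> pp; rewrite -subr_ge0 -varE // var_ge0. Qed.

Lemma var_le_center p f c : is_dist p -> var p f <= avg p (fun s => (f s - c) ^+ 2).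
Proof.
move=> pp; rewrite varE // avg_sqr_center //.
by have := sqr_ge0 (avg p f - c); nra.
Qed.

Lemma var_le_sqr p f H : is_dist p -> (forall s, 0 <= f s <= H) -> var p f <= H ^+ 2.
Proof.
move=> pp fH; apply: (le_trans (var_le_center p f 0 pp)); apply: avg_le => // s.
by case/andP: (fH s) => f0 fh; rewrite subr0; apply: sqr_le_sqr.
Qed.

Lemma avg_itv p f H : is_dist p -> (forall s, 0 <= f s <= H) -> 0 <= avg p f <= H.
Proof.
move=> pp fH; apply/andP; split.
  by apply: avg_ge => // s; case/andP: (fH s).
by apply: avg_le => // s; case/andP: (fH s).
Qed.

Lemma var_sqr_le p f H : is_dist p -> (forall s, 0 <= f s <= H) ->
  var p (fun s => f s ^+ 2) <= 4 * H ^+ 2 * var p f.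
Proof.
move=> pp fH; apply: (le_trans (var_le_center p _ (avg p f ^+ 2) pp)).
rewrite /var -avgZ; apply: le_avg => // s.
have /andP[m0 mH] := avg_itv p f H pp fH; have /andP[f0 fh] := fH s.
set m := avg p f in m0 mH *; have -> : f s ^+ 2 - m ^+ 2 = (f s + m) * (f s - m) by ring.
rewrite exprMn ler_wpM2r ?sqr_ge0 //.
have -> : 4 * H ^+ 2 = (H + H) ^+ 2 by ring.
by apply: sqr_le_sqr; lra.
Qed.

Lemma var_approx p f g eta : is_dist p -> (forall s, `|f s - g s| <= eta) ->
  var p f <= 2 * var p g + 2 * eta ^+ 2.
Proof.
move=> pp fg; apply: (le_trans (var_le_center p f (avg p g) pp)).
rewrite /var -avgZ -[X in _ + X](avg_cst p _ pp) -avgD; apply: le_avg => // s.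
have := sqr_norm_le _ _ (fg s).
set m := avg p g; have := sqr_ge0 ((f s - g s) - (g s - m)); nra.
Qed.

Lemma avg_approx p q f g eta : is_dist p -> is_dist q -> (forall s, `|f s - g s| <= eta) ->
  `|avg q f - avg p f| <= `|avg q g - avg p g| + 2 * eta.
Proof.
move=> pp pq fg.
have -> : avg q f - avg p f = (avg q g - avg p g) +
   (avg q (fun s => f s - g s) - avg p (fun s => f s - g s)) by rewrite !avgB; ring.
have h1 := avg_norm_le p _ eta pp fg; have h2 := avg_norm_le q _ eta pq fg.
apply: (le_trans (ler_normD _ _)); rewrite lerD2l.
by apply: (le_trans (ler_normB _ _)); lra.
Qed.

End Averages.

(** * Mixtures of anchor distributions *)

Section Mixtures.
Context {R : realType} {S : finType} {K : nat}.
Implicit Types (D : 'I_K -> S -> R) (l : 'I_K -> R) (f : S -> R).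

Definition mix l D : S -> R := fun s => \sum_(k < K) l k * D k s.

Lemma avg_mix l D f : avg (mix l D) f = avg l (fun k => avg (D k) f).
Proof.
rewrite /avg /mix; under eq_bigr => s _ do rewrite big_distrl.
rewrite exchange_big; apply: eq_bigr => k _; rewrite big_distrr.
by apply: eq_bigr => s _; rewrite /= mulrA.
Qed.

Lemma is_dist_mix l D : is_dist l -> (forall k, is_dist (D k)) -> is_dist (mix l D).
Proof.
move=> pl pD; split=> [s|].
  by apply: sumr_ge0 => k _; rewrite mulr_ge0 ?pl.1 ?(pD k).1.
rewrite exchange_big -[RHS]pl.2; apply: eq_bigr => k _.
by rewrite -big_distrr /= (pD k).2 mulr1.
Qed.

(** Law of total variance: the variance of the component means, nonnegative by Jensen, is
    dropped. *)
Lemma var_mix l D f : is_dist l -> (forall k, is_dist (D k)) ->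
  avg l (fun k => var (D k) f) <= var (mix l D) f.
Proof.
move=> pl pD; rewrite varE; last exact: is_dist_mix.
rewrite !avg_mix.
rewrite (avg_ext l _ (fun k => avg (D k) (fun s => f s ^+ 2) - avg (D k) f ^+ 2)).
  by rewrite avgB lerD2l lerN2; apply: sqr_avg_le.
by move=> k; rewrite varE.
Qed.

(** Since the bound is linear in the variance, it survives averaging by [var_mix]. Deviation bounds
    at the [K] anchors thus reach every state-action pair with no union bound over [S] and [A]. *)
Lemma avg_mix_dev l D D' f g t b : is_dist l -> (forall k, is_dist (D k)) -> 0 <= t ->
  (forall k, `|avg (D' k) f - avg (D k) f| <= t * var (D k) g + b) ->
  `|avg (mix l D') f - avg (mix l D) f| <= t * var (mix l D) g + b.
Proof.
move=> pl pD t0 dev; rewrite !avg_mix -avgB.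
apply: (@le_trans _ _ (avg l (fun k => t * var (D k) g + b))).
  rewrite ler_norml -[X in X <= _]mulN1r -avgZ; apply/andP; split; apply: le_avg => // k;
  by move: (dev k); rewrite ler_norml ?mulN1r => /andP[].
rewrite avgD avgZ avg_cst // lerD2r ler_wpM2l //; exact: var_mix.
Qed.

End Mixtures.

(** * Discounted values *)

Lemma kernel_dist (R : realType) (S A : finType) (P : S -> A -> S -> R) s a :
  is_kernel P -> is_dist (P s a).
Proof. by case=> P0 P1; split. Qed.

(** At a maximiser of [h] the average of [h] is at most [h] itself, so the hypothesis there reads
    [(1 - gamma) * h <= b]. *)
Lemma discounted_le (R : realType) (S : finType) (p : S -> S -> R) (gamma b : R)
    (h : S -> R) :
  0 <= gamma < 1 -> (forall s, is_dist (p s)) ->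
  (forall s, h s <= gamma * avg (p s) h + b) -> forall s, h s <= b / (1 - gamma).
Proof.
move=> /andP[g0 g1] pp hle s.
case: (@arg_maxP _ _ _ s xpredT h isT) => m _ hm; apply: le_trans (hm s isT) _.
rewrite ler_pdivlMr ?subr_gt0 //.
have := ler_wpM2l g0 (avg_le (p m) h (h m) (pp m) (fun s => hm s isT)).
by have := hle m; lra.
Qed.

Section PolicyValue.
Local Open Scope classical_set_scope.
Context {R : realType} {S A : finType}.
Variables (P : S -> A -> S -> R) (r : S -> A -> R) (gamma : R).
Hypotheses (kP : is_kernel P) (r01 : forall s a, 0 <= r s a <= 1).
Hypothesis gamma01 : 0 < gamma < 1.

Let gamma_ge0 : 0 <= gamma. Proof. by case/andP: gamma01 => /ltW. Qed.
Let gamma_01 : 0 <= gamma < 1. Proof. by case/andP: gamma01 => _ ->; rewrite gamma_ge0. Qed.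
Let horizon_gt0 : 0 < 1 - gamma. Proof. by case/andP: gamma01 => _; rewrite subr_gt0. Qed.

Lemma horizonE : (1 - gamma)^-1 = 1 + gamma * (1 - gamma)^-1.
Proof. by field; rewrite gt_eqF. Qed.

(** [state_dist] grows at the last transition, whereas the Bellman recursion conditions on the first
    one. *)
Lemma state_dist_head pi t s s' :
  state_dist P pi t.+1 s s' = avg (P s (pi s)) (fun u => state_dist P pi t u s').
Proof.
rewrite /avg; elim: t s' => [|t IH] s' /=.
  rewrite (bigD1 s) //= eqxx mul1r big1 ?addr0 => [|u /negPf->]; last by rewrite mul0r.
  rewrite (bigD1 s') //= eqxx mulr1 big1 ?addr0 // => u.
  by rewrite eq_sym => /negPf->; rewrite mulr0.
under eq_bigr => u _ do rewrite -/(state_dist P pi t.+1 s u) IH big_distrl.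
rewrite exchange_big; apply: eq_bigr => u _; rewrite big_distrr.
by apply: eq_bigr => v _; rewrite /= mulrA.
Qed.

Definition Vfin (pi : policy S A) (T : nat) (s : S) : R :=
  \sum_(t < T) gamma ^+ t * \sum_(s' : S) state_dist P pi t s s' * r s' (pi s').

Lemma VfinS pi T s :
  Vfin pi T.+1 s = r s (pi s) + gamma * avg (P s (pi s)) (Vfin pi T).
Proof.
rewrite /Vfin big_ord_recl expr0 mul1r; congr (_ + _).
  rewrite (bigD1 s) //= eqxx mul1r big1 ?addr0 // => u /negPf-> ; by rewrite mul0r.
rewrite /avg big_distrr.
under [RHS]eq_bigr => u _ do rewrite big_distrr big_distrr.
rewrite exchange_big; apply: eq_bigr => t _; rewrite lift0 exprS -mulrA.
under [X in _ * (_ * X)]eq_bigr => s' _ do rewrite state_dist_head /avg big_distrl.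
rewrite exchange_big !big_distrr; apply: eq_bigr => u _ /=.
by rewrite !big_distrr; apply: eq_bigr => s' _ /=; ring.
Qed.

Lemma Vfin_itv pi T s : 0 <= Vfin pi T s <= (1 - gamma)^-1.
Proof.
elim: T s => [|T IH] s.
  by rewrite /Vfin big_ord0 lexx invr_ge0 ltW.
rewrite VfinS; have /andP[a0 aH] := avg_itv _ _ _ (kernel_dist _ _ _ P s (pi s) kP) IH.
have /andP[r0 r1] := r01 s (pi s); apply/andP; split.
  by rewrite addr_ge0 // mulr_ge0.
by rewrite horizonE lerD // ler_wpM2l.
Qed.

Lemma Vfin_nondecreasing pi s : nondecreasing_seq (fun T => Vfin pi T s).
Proof.
apply/nondecreasing_seqP => T; elim: T s => [|T IH] s.
  by rewrite {1}/Vfin big_ord0; case/andP: (Vfin_itv pi 1 s).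
rewrite 2!VfinS lerD2l ler_wpM2l //; apply: le_avg => //; exact: kernel_dist.
Qed.

Lemma Vfin_cvg pi s : (fun T => Vfin pi T s) @ \oo --> Vpi P r gamma pi s.
Proof.
suff h : cvgn (fun T => Vfin pi T s) by exact: h.
apply: nondecreasing_is_cvgn; first exact: Vfin_nondecreasing.
by exists (1 - gamma)^-1 => _ [T _ <-]; case/andP: (Vfin_itv pi T s).
Qed.

Lemma Vpi_bellman pi s :
  Vpi P r gamma pi s = r s (pi s) + gamma * avg (P s (pi s)) (Vpi P r gamma pi).
Proof.
have h1 : (fun T => Vfin pi T.+1 s) @ \oo --> Vpi P r gamma pi s.
  by have := Vfin_cvg pi s; rewrite -cvg_shiftS.
have h2 : (fun T => Vfin pi T.+1 s) @ \oo -->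
    r s (pi s) + gamma * avg (P s (pi s)) (Vpi P r gamma pi).
  under eq_fun do rewrite VfinS.
  apply: cvgD; first exact: cvg_cst.
  apply: cvgMl_tmp; rewrite /avg; apply: cvg_big => [|u _].
    by apply: add_continuous.
  by apply: cvgMl_tmp; apply: Vfin_cvg.
by apply: (cvg_unique _ h1 h2); exact: Rhausdorff.
Qed.

Lemma Vpi_itv pi s : 0 <= Vpi P r gamma pi s <= (1 - gamma)^-1.
Proof.
have c := Vfin_cvg pi s; apply/andP; split.
  by apply: (limr_ge (cvgP _ c)); near=> T; case/andP: (Vfin_itv pi T s).
by apply: (limr_le (cvgP _ c)); near=> T; case/andP: (Vfin_itv pi T s).
Unshelve. all: by end_near.
Qed.

Lemma le_Vpi (pi : policy S A) (f : S -> R) :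
  (forall s, f s <= r s (pi s) + gamma * avg (P s (pi s)) f) ->
  forall s, f s <= Vpi P r gamma pi s.
Proof.
move=> hf s; rewrite -subr_le0.
have := discounted_le R S (fun s => P s (pi s)) gamma 0
  (fun s => f s - Vpi P r gamma pi s) gamma_01 (fun s => kernel_dist _ _ _ P s _ kP).
rewrite mul0r; apply=> u; rewrite avgB {1}Vpi_bellman; have := hf u; lra.
Qed.

Lemma Vpi_le (pi : policy S A) (f : S -> R) :
  (forall s, r s (pi s) + gamma * avg (P s (pi s)) f <= f s) ->
  forall s, Vpi P r gamma pi s <= f s.
Proof.
move=> hf s; rewrite -subr_le0.
have := discounted_le R S (fun s => P s (pi s)) gamma 0
  (fun s => Vpi P r gamma pi s - f s) gamma_01 (fun s => kernel_dist _ _ _ P s _ kP).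
rewrite mul0r; apply=> u; rewrite avgB {1}Vpi_bellman; have := hf u; lra.
Qed.

(* A policy maximising the sum over states of its value is fixed by greedy
   improvement, so it solves the Bellman optimality equation. *)
Lemma Vstar_optimal (pi0 : policy S A) : exists pi : policy S A,
  (forall s, Vstar P r gamma s = Vpi P r gamma pi s) /\
  (forall s a, r s a + gamma * avg (P s a) (Vstar P r gamma) <= Vstar P r gamma s).
Proof.
pose V := Vpi P r gamma.
case: (@arg_maxP _ _ _ pi0 xpredT (fun pi => \sum_s V pi s) isT) => pi _ hmax.
pose q s a := r s a + gamma * avg (P s a) (V pi).
pose gr : policy S A := [ffun s => [arg max_(a > pi s) q s a]%O].
have grP s a : q s a <= q s (gr s).
  by rewrite ffunE; case: arg_maxP => // m _; apply.
have Vgr s : V pi s <= V gr s.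
  by apply: le_Vpi => u; rewrite {1}/V Vpi_bellman; apply: grP.
have Veq s : V gr s = V pi s.
  (* A strict gain at one state, with no loss elsewhere, would raise the maximal sum. *)
  apply/eqP; rewrite eq_le Vgr andbT leNgt; apply/negP => lt.
  have := hmax gr isT; apply/negP; rewrite -ltNge.
  by rewrite (bigD1 s) //= [ltRHS](bigD1 s) //= ltr_leD // ler_sum.
have opt s a : q s a <= V pi s.
  apply: le_trans (grP s a) _; rewrite -Veq /V Vpi_bellman lerD2l ler_wpM2l //.
  by apply: le_avg Vgr; exact: kernel_dist.
have VE s : Vstar P r gamma s = V pi s.
  apply/eqP; rewrite eq_le; apply/andP; split.
    apply: bigmax_le => [|pi' _]; first by case/andP: (Vpi_itv pi s).
    by apply: Vpi_le => u; apply: opt.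
  exact: (le_bigmax _ (fun pi => Vpi P r gamma pi s)).
exists pi; split=> // s a; rewrite VE; apply: le_trans (opt s a).
by rewrite (avg_ext _ _ _ VE).
Qed.

Lemma Vpi_le_Vstar pi s : Vpi P r gamma pi s <= Vstar P r gamma s.
Proof. exact: (le_bigmax _ (fun pi => Vpi P r gamma pi s)). Qed.

End PolicyValue.

(* Both value functions lie in [[0, 1/(1-gamma)]], so the one-step error is at
   most the l1 distance of the kernels divided by [1-gamma]. *)
Lemma Vpi_simulation (R : realType) (S A : finType) (P P' : S -> A -> S -> R)
    (r : S -> A -> R) (gamma x : R) (pi : policy S A) :
  is_kernel P -> is_kernel P' -> (forall s a, 0 <= r s a <= 1) -> 0 < gamma < 1 ->
  (forall s a, \sum_s' `|P' s a s' - P s a s'| <= x) ->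
  forall s, Vpi P' r gamma pi s - Vpi P r gamma pi s <= x / (1 - gamma) ^+ 2.
Proof.
move=> kP kP' r01 g01 hx s; have /andP[g0 g1] := g01.
have h0 : 0 < 1 - gamma by rewrite subr_gt0.
have -> : x / (1 - gamma) ^+ 2 = (x / (1 - gamma)) / (1 - gamma).
  by field; rewrite gt_eqF.
apply: (discounted_le R S (fun s => P s (pi s)) gamma _
  (fun s => Vpi P' r gamma pi s - Vpi P r gamma pi s)).
- by rewrite g1 ltW.
- by move=> u; exact: kernel_dist.
move=> u; set V' := Vpi P' r gamma pi; set V := Vpi P r gamma pi.
have -> : V' u - V u = gamma * avg (P u (pi u)) (fun s => V' s - V s) +
   gamma * (avg (P' u (pi u)) V' - avg (P u (pi u)) V').
  by rewrite avgB {1}/V' {1}/V Vpi_bellman // [X in _ - X]Vpi_bellman // -/V -/V'; ring.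
rewrite lerD2l.
have [V0 VH] : (forall v, 0 <= V' v) /\ (forall v, V' v <= (1 - gamma)^-1).
  by split=> v; have /andP[] := Vpi_itv P' r gamma kP' r01 g01 pi v.
have : avg (P' u (pi u)) V' - avg (P u (pi u)) V' <= x / (1 - gamma).
  rewrite /avg -sumrB; apply: le_trans (_ : _ <= (\sum_s' `|P' u (pi u) s' - P u (pi u) s'|) * (1 - gamma)^-1) _.
    rewrite big_distrl; apply: ler_sum => v _ /=; rewrite -mulrBl.
    apply: (@le_trans _ _ (`|P' u (pi u) v - P u (pi u) v| * V' v)).
      by rewrite ler_wpM2r // ler_norm.
    by rewrite ler_wpM2l.
  by rewrite ler_wpM2r // invr_ge0 ltW.
have : 0 <= x / (1 - gamma).
  rewrite divr_ge0 ?(ltW h0) //; apply: le_trans (hx u (pi u)); exact: sumr_ge0.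
by nra.
Qed.

(** * Concentration *)

Section ProductMeasure.
Context {R : realType} {W S : finType}.
Variable p : W -> S -> R.
Hypothesis pp : forall i, is_dist (p i).
Implicit Types (x : {ffun W -> S}) (i j : W) (s : S).

Definition resample x i s : {ffun W -> S} := [ffun j => if j == i then s else x j].

Definition weight x : R := \prod_(i : W) p i (x i).

Lemma weight_ge0 x : 0 <= weight x.
Proof. by apply: prodr_ge0 => i _; exact: (pp i).1. Qed.

Lemma sum_weight : \sum_x weight x = 1.
Proof.
rewrite /weight -(bigA_distr_bigA p) big1 // => i _; exact: (pp i).2.
Qed.

Lemma weight_resample x i s : weight (resample x i s) * p i (x i) = weight x * p i s.
Proof.
rewrite /weight (bigD1 i) //= [in RHS](bigD1 i) //= ffunE eqxx.
rewrite (eq_bigr (fun j => p j (x j))) => [|j /negPf ji]; first by ring.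
by rewrite ffunE ji.
Qed.

Lemma resampleK x i s : resample (resample x i s) i (x i) = x.
Proof. by apply/ffunP => j; rewrite !ffunE; case: eqP => // ->. Qed.

(* Integrating out one coordinate, by the weight-preserving involution that
   exchanges the i-th coordinate with the fresh sample. *)
Lemma sum_weight_resample i (F : {ffun W -> S} -> R) :
  \sum_x weight x * avg (p i) (fun s => F (resample x i s)) = \sum_x weight x * F x.
Proof.
pose th (y : {ffun W -> S} * S) := (resample y.1 i y.2, y.1 i).
have thK : involutive th.
  by case=> x s; rewrite /th /= resampleK !ffunE eqxx.
rewrite /avg; under eq_bigr => x _ do rewrite big_distrr /=.
rewrite pair_bigA /= (reindex_inj (inv_inj thK)) /=.
rewrite (eq_bigr (fun y => weight y.1 * F y.1 * p i y.2)).
  rewrite -(pair_bigA _ (fun x s => weight x * F x * p i s)) /=.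
  by apply: eq_bigr => x _; rewrite -big_distrr /= (pp i).2 mulr1.
case=> x s _ /=; rewrite resampleK mulrA weight_resample; ring.
Qed.

(** Induction on [l]: integrating out the head coordinate leaves [G] and the other factors unchanged
    and contributes a factor at most 1. [G] may still depend on the coordinates outside [l], here
    the samples of the other anchors. *)
Lemma sum_weight_prod_le1 (l : seq W) (G : {ffun W -> S} -> S -> R) :
  uniq l -> (forall x s, 0 <= G x s) ->
  (forall x i s, i \in l -> G (resample x i s) =1 G x) ->
  (forall x i, i \in l -> avg (p i) (G x) <= 1) ->
  \sum_x weight x * \prod_(i <- l) G x (x i) <= 1.
Proof.
move=> + G0; elim: l => [|i l IH] /= ul Ginv G1.
  by under eq_bigr => x _ do rewrite big_nil mulr1; rewrite sum_weight.
have /andP[il ul'] := ul; rewrite -(sum_weight_resample i).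
apply: le_trans (IH ul' _ _); first last.
- by move=> x j jl; apply: G1; rewrite inE jl orbT.
- by move=> x j s jl; apply: Ginv; rewrite inE jl orbT.
apply: ler_sum => x _; rewrite ler_wpM2l ?weight_ge0 //.
rewrite (avg_ext _ _ (fun s => (\prod_(j <- l) G x (x j)) * G x s)) => [|s].
  rewrite avgZ ler_piMr ?G1 ?mem_head //; exact: prodr_ge0.
rewrite big_cons mulrC ffunE eqxx Ginv ?mem_head //; congr (_ * _).
rewrite !big_seq; apply: eq_bigr => j jl; rewrite ffunE Ginv ?mem_head //.
by case: eqP => // ji; move: il; rewrite -ji jl.
Qed.

End ProductMeasure.

(** Squaring [expR (x / 2) * (1 - x / 2) <= 1] reduces this to a polynomial inequality, with [(1 + x
    + x ^+ 2) * (1 - x / 2) ^+ 2 - 1 = x ^+ 2 * (1 - 3 * x + x ^+ 2) / 4]. *)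
Lemma expR_le_quadratic (R : realType) (x : R) : x <= 3^-1 -> expR x <= 1 + x + x ^+ 2.
Proof.
move=> hx; pose y := expR (x / 2); have y0 : 0 <= y by exact: expR_ge0.
have -> : expR x = y ^+ 2 by rewrite expr2 /y -expRD; congr expR; lra.
have h1 : y * (1 - x / 2) <= 1.
  rewrite -[leRHS](expRxMexpNx_1 (x / 2)) ler_wpM2l //; exact: expR_ge1Dx.
have h2 : (y * (1 - x / 2)) ^+ 2 <= 1.
  by rewrite -[leRHS](expr1n R 2); apply: sqr_le_sqr => //; apply: mulr_ge0 => //; lra.
have h3 : 1 <= (1 + x + x ^+ 2) * (1 - x / 2) ^+ 2.
  have : 0 <= x ^+ 2 * (1 - 3 * x + x ^+ 2).
    by rewrite mulr_ge0 ?sqr_ge0 //; have := sqr_ge0 x; lra.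
  by lra.
rewrite exprMn in h2; have h4 := le_trans h2 h3.
by move: h4; rewrite ler_pM2r // exprn_gt0 //; lra.
Qed.

(** Averaging the quadratic bound on the exponential kills the linear term and leaves
    [1 + t ^+ 2 * var p f], which is at most [expR (t ^+ 2 * var p f)]. *)
Lemma mgf_le1 (R : realType) (S : finType) (p f : S -> R) (t : R) : is_dist p ->
  (forall s, `|t * (f s - avg p f)| <= 3^-1) ->
  avg p (fun s => expR (t * (f s - avg p f) - t ^+ 2 * var p f)) <= 1.
Proof.
move=> pp small; set m := avg p f; set v := var p f.
rewrite (avg_ext p _ (fun s => expR (- (t ^+ 2 * v)) * expR (t * (f s - m)))); last first.
  by move=> s; rewrite -expRD addrC.
rewrite avgZ -[leRHS](expRxMexpNx_1 (t ^+ 2 * v)) mulrC ler_wpM2r ?expR_ge0 //.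
apply: (@le_trans _ _ (1 + t ^+ 2 * v)); last exact: expR_ge1Dx.
apply: (@le_trans _ _ (avg p (fun s => (1 - t * m + t * f s) + t ^+ 2 * (f s - m) ^+ 2))).
  apply: le_avg => // s; have := expR_le_quadratic R _ (le_trans (ler_norm _) (small s)).
  rewrite -/m; lra.
rewrite avgD avgD !avgZ avg_cst // -/m.
have -> : avg p (fun s => (f s - m) ^+ 2) = v by [].
by lra.
Qed.

Lemma avg_emp_anchor (R : realType) (S : finType) (K N : nat) (x : samples S K N)
    (k : 'I_K) (f : S -> R) :
  avg (emp_anchor R x k) f = (\sum_(i < N) f (x (k, i))) / N%:R.
Proof.
rewrite big_distrl /= /avg /emp_anchor.
under [LHS]eq_bigr => s _ do rewrite -sum1_card natr_sum mulrAC big_distrl big_distrl /=.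
rewrite (exchange_big_dep predT) //=; apply: eq_bigr => i _.
rewrite (bigD1 (x (k, i))) ?inE //= mul1r big1 ?addr0 // => s.
by rewrite inE => /andP[/eqP->]; rewrite eqxx.
Qed.

Lemma emp_anchor_dist (R : realType) (S : finType) (K N : nat) (x : samples S K N)
    (k : 'I_K) : (0 < N)%N -> is_dist (emp_anchor R x k).
Proof.
move=> N0; split=> [s|]; first by rewrite divr_ge0 ?ler0n.
have := avg_emp_anchor R S K N x k (fun=> 1); rewrite /avg.
under eq_bigr => s _ do rewrite mulr1.
by move=> ->; rewrite sumr_const card_ord divff // pnatr_eq0 -lt0n.
Qed.

Lemma scaled_deviation (R : realType) (n t d w L : R) : 0 < n -> 0 < t ->
  t * w + L / (n * t) <= d -> L <= n * (t * d - t ^+ 2 * w).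
Proof.
move=> n0 t0; have nt : 0 < n * t by rewrite mulr_gt0.
rewrite -(ler_pM2l nt) mulrDr [X in _ + X]mulrC divfK ?gt_eqF //.
by lra.
Qed.

(* A Bernstein inequality in linearised form: optimising over [t] would give the
   usual square root, but a fixed [t] suffices and keeps the bound linear in the variance. *)
Lemma concentration (R : realType) (S A : finType) (K N : nat)
    (P : S -> A -> S -> R) (anchors : 'I_K -> S * A)
    (F : finType) (k : F -> 'I_K) (v : F -> samples S K N -> S -> R) (t : F -> R) (L : R)
    (E : samples S K N -> Prop) :
  let D j := P (anchors j).1 (anchors j).2 in
  is_kernel P -> (F -> (0 < N)%N) -> (forall f, 0 < t f) ->
  (forall f x i s, v f (resample x (k f, i) s) =1 v f x) ->
  (forall f x s, `|t f * (v f x s - avg (D (k f)) (v f x))| <= 3^-1) ->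
  (forall x, (forall f,
     `|avg (emp_anchor R x (k f)) (v f x) - avg (D (k f)) (v f x)| <=
       t f * var (D (k f)) (v f x) + L / (N%:R * t f)) -> E x) ->
  1 - 2 * #|F|%:R * expR (- L) <= prob_event P anchors E.
Proof.
move=> D kP N0 t0 vinv small good.
pose p (i : 'I_K * 'I_N) := D i.1.
have pp i : is_dist (p i) by exact: kernel_dist.
pose g (f : F) (u : R) x s :=
  expR (u * (v f x s - avg (D (k f)) (v f x)) - u ^+ 2 * var (D (k f)) (v f x)).
pose Z f u x := \prod_(i <- enum 'I_N) g f u x (x (k f, i)).
(* Both signs of [u] are needed to control the absolute deviation. By [vinv], [v f] is frozen while
   the samples of anchor [k f] are integrated out. *)
have EZ f u : (u = t f \/ u = - t f) -> \sum_x weight p x * Z f u x <= 1.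
  move=> ut; have inj : injective (fun i : 'I_N => (k f, i)) by move=> i j [].
  have := @sum_weight_prod_le1 R _ S p pp [seq (k f, i) | i <- enum 'I_N] (g f u).
  under eq_bigr => x _ do rewrite big_map.
  apply.
  - by rewrite map_inj_uniq // enum_uniq.
  - by move=> x s; exact: expR_ge0.
  - move=> x _ s /mapP[i _ ->] s'; rewrite /g.
    by rewrite /g (avg_ext _ _ _ (vinv f x i s)) (var_ext _ _ _ (vinv f x i s)) vinv.
  - move=> x _ /mapP[i _ ->]; apply: mgf_le1; first exact: pp.
    by move=> s; case: ut => ->; rewrite ?mulNr ?normrN.
have ZE f u x : Z f u x = expR (N%:R * (u * (avg (emp_anchor R x (k f)) (v f x) -
    avg (D (k f)) (v f x)) - u ^+ 2 * var (D (k f)) (v f x))).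
  rewrite /Z big_enum /= -expR_sum; congr expR.
  rewrite sumrB -big_distrr /= sumrB !sumr_const card_ord avg_emp_anchor.
  rewrite -(mulr_natl (avg _ _)) -(mulr_natl (_ * var _ _)); field.
  by rewrite pnatr_eq0 -lt0n (N0 f).
(* Chernoff step: outside [E] some deviation exceeds its bound, and the exponential with the
   matching sign is then at least [expR L]. *)
have bad x : ~ E x -> 1 <= expR (- L) * \sum_f (Z f (t f) x + Z f (- t f) x).
  move=> nE.
  have /existsNP[f] : ~ forall f,
     `|avg (emp_anchor R x (k f)) (v f x) - avg (D (k f)) (v f x)| <=
       t f * var (D (k f)) (v f x) + L / (N%:R * t f) by move/good.
  set dev := (X in `|X|) => /negP; rewrite -ltNge => big.
  have ZLE : expR L <= Z f (t f) x + Z f (- t f) x.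
    have NR : 0 < N%:R :> R by rewrite ltr0n (N0 f).
    have : L <= N%:R * (t f * `|dev| - t f ^+ 2 * var (D (k f)) (v f x)).
      exact: scaled_deviation (ltW big).
    rewrite !ZE -/dev -ler_expR sqrrN => h; apply: le_trans h _.
    by case: (ger0P dev) => _; rewrite ?mulrN ?mulNr ?(lerDl, lerDr) expR_ge0.
  rewrite -[leLHS](expRxMexpNx_1 L) mulrC ler_wpM2l ?expR_ge0 //; apply: le_trans ZLE _.
  by rewrite (bigD1 f) //= lerDl sumr_ge0 // => f' _; rewrite addr_ge0 // ZE expR_ge0.
rewrite lerBlDr -[leLHS](sum_weight p pp) /prob_event (bigID (fun x => `[< E x >])) /= lerD2l.
apply: (@le_trans _ _ (expR (- L) * \sum_f (\sum_x weight p x * Z f (t f) x +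
    \sum_x weight p x * Z f (- t f) x))); last first.
  rewrite mulrC ler_wpM2r ?expR_ge0 //.
  apply: (@le_trans _ _ (\sum_(f : F) 2)).
    by apply: ler_sum => f _; apply: lerD; apply: EZ; [left | right].
  by rewrite sumr_const -[leLHS]mulr_natr.
under [X in _ <= _ * X]eq_bigr => f _ do rewrite -big_split /=.
rewrite exchange_big big_distrr /= [leRHS](bigID (fun x => `[< E x >])) /=.
rewrite -[leLHS]add0r lerD //.
  apply: sumr_ge0 => x _; apply: mulr_ge0; first exact: expR_ge0.
  apply: sumr_ge0 => f _; rewrite -mulrDr mulr_ge0 ?weight_ge0 //.
  by rewrite addr_ge0 // ZE expR_ge0.
apply: ler_sum => x /asboolPn nE.
under eq_bigr => f _ do rewrite -mulrDr.
rewrite -big_distrr /= mulrCA -[leLHS]mulr1 ler_wpM2l ?weight_ge0 //.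
exact: bad.
Qed.

(** * Propagation of the estimation errors *)

Section VarianceBounds.
Context {R : realType} {S : finType}.
Variable gamma : R.
Hypothesis gamma01 : 0 < gamma < 1.
Let H := (1 - gamma)^-1.

Let H_gt0 : 0 < H.
Proof. by case/andP: gamma01 => _; rewrite invr_gt0 subr_gt0. Qed.

(** Only [gamma ^+ 2 <= gamma] is lost. The right side telescopes with the Bellman equation, as
    [gamma * avg q f] is the value minus the reward. *)
Lemma discounted_var_le (q f : S -> R) : is_dist q ->
  gamma * var q f <= gamma * avg q (fun s => f s ^+ 2) - (gamma * avg q f) ^+ 2.
Proof.
move=> qq; have /andP[g0 g1] := gamma01; rewrite varE // mulrBr lerD2l lerN2 exprMn.
by rewrite ler_wpM2r ?sqr_ge0 // expr2 ler_piMl ?ltW.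
Qed.

(* [f - W + 2 t f^2] is discounted subharmonic: the drift of [f^2] pays for the
   variance in the bound on the Bellman residual of [f]. *)
Lemma bellman_residual_gap (p : S -> S -> R) (rew f W : S -> R) (t q : R) :
  (forall s, is_dist (p s)) -> (forall s, 0 <= rew s <= 1) ->
  (forall s, 0 <= f s <= H) -> 0 <= t -> 4 * H * t <= 1 ->
  (forall s, W s = rew s + gamma * avg (p s) W) ->
  (forall s, `|f s - (rew s + gamma * avg (p s) f)| <= gamma * t * var (p s) f + q) ->
  forall s, f s - W s <= (2 * q + 4 * H * t) * H.
Proof.
move=> pp r01 fH t0 tH WE res s; have /andP[g0 g1] := gamma01.
apply: (@le_trans _ _ (f s - W s + 2 * t * f s ^+ 2)).
  by rewrite lerDl mulr_ge0 ?sqr_ge0 // mulr_ge0.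
apply: (discounted_le R S p gamma _ (fun s => f s - W s + 2 * t * f s ^+ 2)) => //.
  by rewrite ltW.
move=> {s} s; rewrite avgD avgB avgZ {1}WE.
have dv := discounted_var_le (p s) f (pp s); have v0 := var_ge0 (p s) f (pp s).
move: dv v0 (res s) (fH s) (r01 s).
set m := avg (p s) f; set m2 := avg (p s) _; set v := var (p s) f.
set mW := avg (p s) W; set x := f s; set y := rew s => dv v0.
set e := x - _ => he /andP[x0 xH] /andP[y0 y1].
have gm : gamma * m = x - y - e by rewrite /e; ring.
rewrite gm in dv.
have e1 : e <= `|e| := ler_norm e.
have : (1 + 4 * H * t) * `|e| <= 2 * (gamma * t * v + q).
  apply: (@le_trans _ _ (2 * `|e|)); last by rewrite ler_wpM2l.
  by rewrite ler_wpM2r //; lra.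
have hx : x * (y + e) <= H * (1 + `|e|).
  apply: (@le_trans _ _ (x * (1 + `|e|))); last by rewrite ler_wpM2r //; apply: addr_ge0.
  by rewrite ler_wpM2l //; lra.
(* Since [gamma * m = x - (y + e)], the difference [x ^+ 2 - (gamma * m) ^+ 2] is
   [2 * x * (y + e) - (y + e) ^+ 2], of order [H] rather than [H ^+ 2]. *)
have drift : x ^+ 2 - gamma * m2 <= 2 * (H * (1 + `|e|)) - gamma * v.
  have := sqr_ge0 (y + e); nra.
have := ler_wpM2l t0 drift.
have -> : x - (y + gamma * mW) + 2 * t * x ^+ 2 =
  gamma * (m - mW + 2 * t * m2) + (e + 2 * (t * (x ^+ 2 - gamma * m2))).
  by rewrite /e; ring.
by lra.
Qed.

(** The maximum principle runs under [p'] on [f - g + 2 t f^2], while the variance is taken under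
    [p]; exchanging the two second moments is what requires a deviation bound for [f^2]. Of the
    drift [2 gamma t var], the deviation of [f] uses one half and that of [f^2] one quarter. *)
Lemma optimal_value_gap (p p' : S -> S -> R) (rew f g : S -> R) (t b b2 : R) :
  (forall s, is_dist (p s)) -> (forall s, is_dist (p' s)) ->
  (forall s, 0 <= rew s <= 1) -> (forall s, 0 <= f s <= H) ->
  0 <= t -> 0 <= b -> 0 <= b2 ->
  (forall s, f s = rew s + gamma * avg (p s) f) ->
  (forall s, rew s + gamma * avg (p' s) g <= g s) ->
  (forall s, `|avg (p' s) f - avg (p s) f| <= t * var (p s) f + b) ->
  (forall s, `|avg (p' s) (fun u => f u ^+ 2) - avg (p s) (fun u => f u ^+ 2)|
     <= 4^-1 * var (p s) f + b2) ->
  forall s, f s - g s <= (b + 4 * H * t + 2 * t * b2) * H.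
Proof.
move=> pp pp' r01 fH t0 b0 b20 fE gE dev dev2 s; have /andP[g0 g1] := gamma01.
apply: (@le_trans _ _ (f s - g s + 2 * t * f s ^+ 2)).
  by rewrite lerDl mulr_ge0 ?sqr_ge0 // mulr_ge0.
apply: (discounted_le R S p' gamma _ (fun s => f s - g s + 2 * t * f s ^+ 2)) => //.
  by rewrite ltW.
move=> {s} s; rewrite avgD avgB avgZ.
have dv := discounted_var_le (p s) f (pp s); have v0 := var_ge0 (p s) f (pp s).
move: dv v0 (fE s) (gE s) (dev s) (dev2 s) (fH s) (r01 s).
set m := avg (p s) f; set m2 := avg (p s) _; set v := var (p s) f.
set m' := avg (p' s) f; set m2' := avg (p' s) (fun s0 => f s0 ^+ 2).
set mg := avg (p' s) g; set x := f s; set y := rew s; set z := g s.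
move=> dv v0 xE zE; rewrite !ler_norml => /andP[d1 _] /andP[d2 _] /andP[x0 xH] /andP[y0 y1].
have xy : x * y <= H by rewrite -[H]mulr1 ler_pM.
have drift : x ^+ 2 - gamma * m2 <= 2 * H - gamma * v.
  have gm : gamma * m = x - y by lra.
  by rewrite gm in dv; have := sqr_ge0 y; lra.
have h1 : gamma * (m - m') <= gamma * (t * v) + b.
  apply: (@le_trans _ _ (gamma * (t * v + b))); first by rewrite ler_wpM2l ?(ltW g0) //; lra.
  by rewrite mulrDr lerD2l ler_piMl // ltW.
have h2 : gamma * (m2 - m2') <= gamma * v / 4 + b2.
  apply: (@le_trans _ _ (gamma * (v / 4 + b2))); first by rewrite ler_wpM2l ?(ltW g0) //; lra.
  by rewrite mulrDr mulrA lerD2l ler_piMl // ltW.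
have := ler_wpM2l t0 (lerD drift h2).
have : 0 <= gamma * (t * v) by rewrite !mulr_ge0 // ltW.
by lra.
Qed.

End VarianceBounds.

(** * Decoupling the optimal value from the samples of one anchor *)

Section LeaveOneOut.
Context {R : realType} {S A : finType} {K : nat}.
Variables (r : S -> A -> R) (gamma : R) (lam : S -> A -> 'I_K -> R).
Hypotheses (r01 : forall s a, 0 <= r s a <= 1) (gamma01 : 0 < gamma < 1).
Hypothesis lam_dist : forall s a, is_dist (lam s a).
Let H := (1 - gamma)^-1.

Let g0 : 0 <= gamma. Proof. by case/andP: gamma01 => /ltW. Qed.
Let H_ge0 : 0 <= H.
Proof. by case/andP: gamma01 => _ g1; rewrite invr_ge0 subr_ge0 ltW. Qed.

Definition loo_backup (D : 'I_K -> S -> R) (k : 'I_K) (w : R) (U : S -> R) (s : S) (a : A) : R :=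
  r s a + gamma * (\sum_(i < K | i != k) lam s a i * avg (D i) U + lam s a k * w).

(* The Bellman operator in which the expectation under anchor [k] is frozen to the
   scalar [w]; its iterates do not depend on the samples of that anchor. *)
Definition loo_step (D : 'I_K -> S -> R) k w U s : R :=
  Num.min (1 - gamma)^-1 (\big[Num.max/0]_(a : A) loo_backup D k w U s a).

(** A finite iterate stands in for the fixed point, at the cost of a term [gamma ^+ n * H]. *)
Definition loo_value D k w n : S -> R := iter n (loo_step D k w) (fun=> 0).

(** The clipping in [loo_step] gives this for every [w], including grid points outside the range of
    values. *)
Lemma loo_step_itv D k w U s : 0 <= loo_step D k w U s <= H.
Proof. by rewrite le_min ge_min H_ge0 lexx bigmax_ge_id. Qed.

Lemma loo_value_itv D k w n s : 0 <= loo_value D k w n s <= H.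
Proof. by case: n => [|n]; rewrite ?lexx //; exact: loo_step_itv. Qed.

(** Resampling anchor [k] alters only [D k], so this provides the invariance that [concentration]
    asks for. *)
Lemma loo_value_ext D D' k w n : (forall i, i != k -> D i =1 D' i) ->
  loo_value D k w n =1 loo_value D' k w n.
Proof.
move=> DD' s; rewrite (_ : loo_value D k w n = loo_value D' k w n) //.
elim: n => // n IH; rewrite /loo_value !iterS -/(loo_value D k w n) IH.
apply/funext => u; congr (Num.min _ _); apply: eq_bigr => a _.
congr (_ + _ * (_ + _)); apply: eq_bigr => i ik; congr (_ * _).
by apply: eq_bigr => v _; rewrite DD'.
Qed.

Lemma loo_step_le D k w w' U U' (e e' : R) : (forall i, is_dist (D i)) ->
  0 <= e -> 0 <= e' -> (forall s, U s <= U' s + e) -> w <= w' + e' ->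
  forall s, loo_step D k w U s <= loo_step D k w' U' s + (gamma * e + e').
Proof.
move=> DD e0 e'0 UU' ww' s; have /andP[_ g1] := gamma01.
have E0 : 0 <= gamma * e + e' by rewrite addr_ge0 // mulr_ge0.
rewrite /loo_step addr_minl; apply: le_min2; first by rewrite lerDl.
apply: bigmax_le => [|a _]; first by apply: addr_ge0 => //; exact: bigmax_ge_id.
apply: (@le_trans _ _ (loo_backup D k w' U' s a + (gamma * e + e'))); last first.
  by rewrite lerD2r; exact: (le_bigmax _ (loo_backup D k w' U' s)).
have l1 := (lam_dist s a).2; have l0 := (lam_dist s a).1.
rewrite /loo_backup -addrA lerD2l.
have h1 : \sum_(i < K | i != k) lam s a i * avg (D i) U <=
   \sum_(i < K | i != k) lam s a i * avg (D i) U' + e.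
  apply: (@le_trans _ _ (\sum_(i < K | i != k) (lam s a i * avg (D i) U' + lam s a i * e))).
    apply: ler_sum => i _; rewrite -mulrDr ler_wpM2l // -[X in _ + X](avg_cst (D i) e (DD i)) -avgD.
    exact: le_avg.
  rewrite big_split /= lerD2l -big_distrl /= ler_piMl // -l1 [leRHS](bigD1 k) //=.
  by rewrite lerDr.
have lk1 : lam s a k <= 1 by rewrite -l1 (bigD1 k) //= lerDl sumr_ge0.
have h2 : lam s a k * w <= lam s a k * w' + e'.
  apply: (@le_trans _ _ (lam s a k * (w' + e'))); first exact: ler_wpM2l.
  by rewrite mulrDr lerD2l ler_piMl.
have h3 : gamma * e' <= e' by rewrite ler_piMl // ltW.
have := ler_wpM2l g0 (lerD h1 h2); lra.
Qed.

Variables (D : 'I_K -> S -> R) (pi0 : policy S A).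
Hypothesis DD : forall i, is_dist (D i).
Let P (s : S) (a : A) := mix (lam s a) D.

Lemma mix_kernel : is_kernel P.
Proof.
split=> s a; last exact: (is_dist_mix _ _ (lam_dist s a) DD).2.
exact: (is_dist_mix _ _ (lam_dist s a) DD).1.
Qed.

Lemma Vstar_itv s : 0 <= Vstar P r gamma s <= H.
Proof.
have [pi [-> _]] := Vstar_optimal P r gamma mix_kernel r01 gamma01 pi0.
exact: Vpi_itv mix_kernel r01 gamma01 pi s.
Qed.

Lemma Vstar_loo k s :
  Vstar P r gamma s = loo_step D k (avg (D k) (Vstar P r gamma)) (Vstar P r gamma) s.
Proof.
set V := Vstar P r gamma.
have backupE a : loo_backup D k (avg (D k) V) V s a = r s a + gamma * avg (P s a) V.
  by rewrite /P avg_mix /loo_backup [in RHS]/avg [in RHS](bigD1 k) //= addrC [in RHS]addrC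
     [in LHS](addrC (\sum_(i | _) _)).
have [pi [VE opt]] := Vstar_optimal P r gamma mix_kernel r01 gamma01 pi0.
rewrite -/V in VE opt; have /andP[V0 VH] := Vstar_itv s.
have -> : loo_step D k (avg (D k) V) V s = Num.min (1 - gamma)^-1 (V s); last first.
  by rewrite min_r.
congr (Num.min _ _); apply/eqP; rewrite eq_le; apply/andP; split.
  by apply: bigmax_le => // a _; rewrite backupE; exact: opt.
apply: (@le_trans _ _ (loo_backup D k (avg (D k) V) V s (pi s))); last exact: le_bigmax.
rewrite backupE (avg_ext _ _ _ VE) VE Vpi_bellman //; exact: mix_kernel.
Qed.

(** Contraction from both sides: an error [e] becomes [gamma * e + e'], where [e'] is the error in
    [w], and [H = 1 + gamma * H] makes the stated bound reproduce itself. *)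
Lemma loo_value_approx k w n s :
  `|Vstar P r gamma s - loo_value D k w n s| <=
    gamma ^+ n * H + `|w - avg (D k) (Vstar P r gamma)| * H.
Proof.
set V := Vstar P r gamma; set e' := `|w - _|.
have HE : H = 1 + gamma * H by rewrite /H; exact: horizonE.
have e'0 : 0 <= e' by exact: normr_ge0.
elim: n s => [|n IH] s.
  have /andP[V0 VH] := Vstar_itv s.
  by rewrite subr0 expr0 mul1r ger0_norm // (le_trans VH) // lerDl mulr_ge0.
pose e := gamma ^+ n * H + e' * H.
have e0 : 0 <= e by rewrite addr_ge0 // mulr_ge0 // exprn_ge0.
have -> : gamma ^+ n.+1 * H + e' * H = gamma * e + e'.
  by rewrite /e exprS {2}HE; ring.
have IHl u : V u <= loo_value D k w n u + e.
  by have := IH u; rewrite ler_norml => /andP[_]; rewrite lerBlDl.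
have IHr u : loo_value D k w n u <= V u + e.
  by have := IH u; rewrite ler_norml => /andP[+ _]; rewrite lerNl opprB lerBlDl.
have wl : avg (D k) V <= w + e'.
  by have := ler_norm (avg (D k) V - w); rewrite distrC -/e' lerBlDl.
have wr : w <= avg (D k) V + e'.
  by have := ler_norm (w - avg (D k) V); rewrite -/e' lerBlDl.
have hl := loo_step_le D k _ _ _ _ e e' DD e0 e'0 IHl wl s.
have hr := loo_step_le D k _ _ _ _ e e' DD e0 e'0 IHr wr s.
rewrite -Vstar_loo -/V in hl hr; rewrite -/(loo_step _ _ _ _ _).
by rewrite ler_norml lerNl opprB !lerBlDl hl hr.
Qed.

End LeaveOneOut.

(** * Loss of the plug-in policy under the mean kernel *)

Section PlugIn.
Context {R : realType} {S A : finType} {K : nat}.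
Variables (r : S -> A -> R) (gamma : R) (lam : S -> A -> 'I_K -> R).
Variables (D D' : 'I_K -> S -> R) (pi : policy S A).
Hypotheses (r01 : forall s a, 0 <= r s a <= 1) (gamma01 : 0 < gamma < 1).
Hypothesis lam_dist : forall s a, is_dist (lam s a).
Hypotheses (DD : forall k, is_dist (D k)) (DD' : forall k, is_dist (D' k)).
Let P (s : S) (a : A) := mix (lam s a) D.
Let P' (s : S) (a : A) := mix (lam s a) D'.
Let V := Vstar P r gamma.
Let V' := Vstar P' r gamma.
Let H := (1 - gamma)^-1.

Let kP : is_kernel P. Proof. exact: mix_kernel. Qed.
Let kP' : is_kernel P'. Proof. exact: mix_kernel. Qed.
Let gammaW : 0 <= gamma < 1. Proof. by case/andP: gamma01 => /ltW -> ->. Qed.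
Let V_itv s : 0 <= V s <= H.
Proof. exact: (Vstar_itv _ _ _ r01 gamma01 lam_dist _ pi DD). Qed.
Let V'_itv s : 0 <= V' s <= H.
Proof. exact: (Vstar_itv _ _ _ r01 gamma01 lam_dist _ pi DD'). Qed.

(** Each direction follows the policy optimal for the larger value, and both maximum principles run
    under [P'], so that only the deviation of [V], never that of [V'], is involved. *)
Lemma Vstar_perturb (B : R) :
  (forall k, `|avg (D' k) V - avg (D k) V| <= B) ->
  forall s, `|V' s - V s| <= gamma * B * H.
Proof.
move=> dev s; have /andP[g0 g1] := gammaW.
have devP u a : `|avg (P' u a) V - avg (P u a) V| <= B.
  by rewrite /P /P' !avg_mix -avgB; exact: avg_norm_le.
rewrite ler_norml lerNl opprB; apply/andP; split.
- have [pis [VE opt]] := Vstar_optimal P r gamma kP r01 gamma01 pi.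
  have [_ [_ opt']] := Vstar_optimal P' r gamma kP' r01 gamma01 pi.
  apply: (discounted_le R S (fun s => P' s (pis s)) gamma _ (fun s => V s - V' s)) => // [u|u].
    exact: kernel_dist.
  have := opt' u (pis u); have := devP u (pis u); rewrite ler_norml -/V' => /andP[lo _].
  have Vu : V u = r u (pis u) + gamma * avg (P u (pis u)) V.
    by rewrite /V (avg_ext _ _ _ VE) VE Vpi_bellman.
  have := ler_wpM2l g0 lo; rewrite avgB {1}Vu; lra.
- have [pis [VE opt]] := Vstar_optimal P' r gamma kP' r01 gamma01 pi.
  have [_ [_ opt']] := Vstar_optimal P r gamma kP r01 gamma01 pi.
  apply: (discounted_le R S (fun s => P' s (pis s)) gamma _ (fun s => V' s - V s)) => // [u|u].
    exact: kernel_dist.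
  have := opt' u (pis u); have := devP u (pis u); rewrite ler_norml -/V => /andP[_ hi].
  have Vu : V' u = r u (pis u) + gamma * avg (P' u (pis u)) V'.
    by rewrite /V' (avg_ext _ _ _ VE) VE Vpi_bellman.
  have := ler_wpM2l g0 hi; rewrite avgB {1}Vu; lra.
Qed.

(** [V'] depends on all samples, so each anchor supplies its own surrogate [G] with a deviation
    bound. Passing from [G] back to [V'] doubles the variance coefficient to [2 * t], whence the
    condition [8 * H * t <= 1]. *)
Lemma plug_in_gap (t eta b b2 eps_PS : R) :
  0 <= t -> 8 * H * t <= 1 -> 0 <= eta -> 0 <= b -> 0 <= b2 ->
  eps_optimal P' r gamma eps_PS pi ->
  (forall k, `|avg (D' k) V - avg (D k) V| <= t * var (D k) V + b) ->
  (forall k, `|avg (D' k) (fun s => V s ^+ 2) - avg (D k) (fun s => V s ^+ 2)| <=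
     (16 * H ^+ 2)^-1 * var (D k) (fun s => V s ^+ 2) + b2) ->
  (forall k, exists G : S -> R, (forall s, `|V' s - G s| <= eta) /\
     `|avg (D' k) G - avg (D k) G| <= t * var (D k) G + b) ->
  forall s, V s - Vpi P r gamma pi s <=
    (2 * (b + 2 * eta + 2 * t * eta ^+ 2 + eps_PS) + 8 * H * t) * H +
    (b + 4 * H * t + 2 * t * b2) * H.
Proof.
move=> t0 Ht eta0 b0 b20 opt_pi c1 c2 c3 s; have /andP[g0 g1] := gammaW.
have H0 : 0 < H by rewrite invr_gt0 subr_gt0.
have [pis [VE opt]] := Vstar_optimal P r gamma kP r01 gamma01 pi.
have [_ [_ opt']] := Vstar_optimal P' r gamma kP' r01 gamma01 pi.
rewrite -/V in VE opt; rewrite -/V' in opt'.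
have t20 : 0 <= 2 * t by rewrite mulr_ge0.
have dev' u a : `|avg (P' u a) V' - avg (P u a) V'| <=
    2 * t * var (P u a) V' + (b + 2 * eta + 2 * t * eta ^+ 2).
  apply: avg_mix_dev => // k; have [G [VG cG]] := c3 k.
  apply: (le_trans (avg_approx (D k) (D' k) V' G eta (DD k) (DD' k) VG)).
  have VG' v : `|G v - V' v| <= eta by rewrite distrC.
  have := ler_wpM2l t0 (var_approx (D k) G V' eta (DD k) VG').
  by lra.
have -> : V s - Vpi P r gamma pi s = (V' s - Vpi P r gamma pi s) + (V s - V' s) by ring.
apply: lerD.
  have := bellman_residual_gap gamma gamma01 (fun s => P s (pi s)) (fun s => r s (pi s))
    V' (Vpi P r gamma pi) (2 * t) (b + 2 * eta + 2 * t * eta ^+ 2 + eps_PS).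
  rewrite (_ : 4 * (1 - gamma)^-1 * (2 * t) = 8 * H * t); last by rewrite /H; ring.
  apply=> //.
  - by move=> u; exact: kernel_dist.
  - by move=> u; rewrite {1}Vpi_bellman.
  move=> u; have dv := dev' u (pi u).
  (* The residual of [V'] under [P] splits into its residual under [P'], between 0 and [eps_PS] by
     near-optimality of [pi], and [gamma] times the deviation of [V']. *)
  have lo : 0 <= V' u - (r u (pi u) + gamma * avg (P' u (pi u)) V').
    by rewrite subr_ge0.
  have hi : V' u - (r u (pi u) + gamma * avg (P' u (pi u)) V') <= eps_PS.
    have := opt_pi u; rewrite -/V' Vpi_bellman //.
    have : avg (P' u (pi u)) (Vpi P' r gamma pi) <= avg (P' u (pi u)) V'.
      by apply: le_avg => [|v]; [exact: kernel_dist | exact: Vpi_le_Vstar].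
    by move=> /(ler_wpM2l g0); lra.
  have gdv : gamma * `|avg (P' u (pi u)) V' - avg (P u (pi u)) V'| <=
      gamma * (2 * t) * var (P u (pi u)) V' + (b + 2 * eta + 2 * t * eta ^+ 2).
    have bA0 : 0 <= b + 2 * eta + 2 * t * eta ^+ 2 by rewrite !addr_ge0 ?mulr_ge0 ?sqr_ge0.
    have := ler_wpM2l g0 dv; have := ler_piMl bA0 (ltW g1); lra.
  have -> : V' u - (r u (pi u) + gamma * avg (P u (pi u)) V') =
    (V' u - (r u (pi u) + gamma * avg (P' u (pi u)) V')) +
    gamma * (avg (P' u (pi u)) V' - avg (P u (pi u)) V') by ring.
  apply: le_trans (ler_normD _ _) _; rewrite ger0_norm // normrM (ger0_norm g0).
  by rewrite [leRHS]addrA [leRHS]addrC; apply: lerD.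
apply: (optimal_value_gap gamma gamma01 (fun s => P s (pis s)) (fun s => P' s (pis s))
  (fun s => r s (pis s))) => //.
- by move=> u; exact: kernel_dist.
- by move=> u; exact: kernel_dist.
- by move=> u; rewrite (avg_ext _ _ _ VE) VE Vpi_bellman.
- by move=> u; exact: avg_mix_dev.
- move=> u; apply: avg_mix_dev => [||//|k]; [exact: lam_dist | exact: DD | ].
  (* By [var_sqr_le] the variance of [V^2] is at most [4 * H ^+ 2] times that of [V]; dividing by
     [16 * H ^+ 2] gives the coefficient [4^-1]. *)
  apply: le_trans (c2 k) _; rewrite lerD2r.
  have H2 : 0 < 16 * H ^+ 2 by rewrite mulr_gt0 // exprn_gt0.
  rewrite mulrC ler_pdivrMr //; apply: (le_trans (var_sqr_le _ _ H (DD k) V_itv)).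
  by rewrite le_eqVlt; apply/orP; left; apply/eqP; field.
Qed.

Lemma frozen_value_dev (B : R) (k : 'I_K) :
  (forall k, `|avg (D' k) V - avg (D k) V| <= B) ->
  `|avg (D' k) V' - avg (D k) V| <= B * H.
Proof.
move=> dev; have H1 : H = 1 + gamma * H by rewrite /H; exact: horizonE.
rewrite [H in _ <= _ * H]H1 mulrDr mulr1 mulrCA mulrA.
have -> : avg (D' k) V' - avg (D k) V =
  (avg (D' k) V - avg (D k) V) + avg (D' k) (fun s => V' s - V s) by rewrite avgB; ring.
apply: (le_trans (ler_normD _ _)); apply: lerD => //.
by apply: avg_norm_le => //; exact: Vstar_perturb.
Qed.

End PlugIn.

Lemma grid_point (R : realType) (w0 w rad s : R) (M : nat) :
  0 < s -> `|w - w0| <= rad -> 2 * rad / s < M%:R ->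
  exists j : 'I_M, `|w0 - rad + j%:R * s - w| <= s.
Proof.
move=> s0; rewrite ler_norml => /andP[lo hi] hM.
pose y := (w - w0 + rad) / s.
have y0 : 0 <= y by rewrite divr_ge0 ?(ltW s0) //; lra.
have yM : y < M%:R by apply: le_lt_trans hM; rewrite ler_pM2r ?invr_gt0 //; lra.
have /andP[jy yj] := truncn_itv y0.
have jM : (Num.truncn y < M)%N by rewrite -(ltr_nat R); apply: le_lt_trans yM.
exists (Ordinal jM) => /=; set j := Num.truncn y in jy yj *.
have yE : w - w0 + rad = y * s by rewrite /y divfK // gt_eqF.
move: jy yj; rewrite -natr1 => jy yj.
have h1 := ler_wpM2r (ltW s0) jy; have h2 := ler_wpM2r (ltW s0) (ltW yj).
rewrite ler_norml; apply/andP; split; lra.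
Qed.

(** * Choice of the parameters *)

Lemma resample_emp_anchor (R : realType) (S : finType) (K N : nat) (x : samples S K N)
    (k k' : 'I_K) (i : 'I_N) (s : S) : k' != k ->
  emp_anchor R (resample x (k, i) s) k' =1 emp_anchor R x k'.
Proof.
move=> kk' u; rewrite /emp_anchor; congr (_%:R / _); apply: eq_card => j.
by rewrite !inE ffunE xpair_eqE (negPf kk').
Qed.

Lemma scaled_dev_le (R : realType) (S : finType) (p f : S -> R) (t B : R) (s : S) :
  is_dist p -> (forall u, 0 <= f u <= B) -> 0 <= t -> t * B <= 3^-1 ->
  `|t * (f s - avg p f)| <= 3^-1.
Proof.
move=> pp fB t0 tB; apply: le_trans tB; rewrite normrM ger0_norm // ler_wpM2l //.
have /andP[m0 mB] := avg_itv _ _ _ pp fB; have /andP[f0 fb] := fB s.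
by rewrite ler_norml; lra.
Qed.

(** The terms in [b], [eta] and [t * H ^+ 2] take [eps / 8], [eps / 8] and [eps / 4]; the remaining
    two are of lower order, the one in [eta ^+ 2] thanks to [eps ^+ 2 <= H]. *)
Lemma gap_parameters (R : realType) (H eps eps_PS b b2 : R) :
  let t := eps / (48 * H ^+ 2) in let eta := eps / (32 * H) in
  1 <= H -> 0 < eps -> eps ^+ 2 <= H -> b <= eps / (24 * H) -> b2 <= 1 ->
  (2 * (b + 2 * eta + 2 * t * eta ^+ 2 + eps_PS) + 8 * H * t) * H +
    (b + 4 * H * t + 2 * t * b2) * H <= eps + 2 * eps_PS * H.
Proof.
move=> t eta H1 e0 eH hb hb2; have H0 : 0 < H by lra.
have hbH : b * H <= eps / 24.
  have -> : eps / 24 = eps / (24 * H) * H by field; rewrite gt_eqF.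
  by rewrite ler_wpM2r // ltW.
have etaH : eta * H = eps / 32 by rewrite /eta; field; rewrite gt_eqF.
have tHH : t * H * H = eps / 48 by rewrite /t; field; rewrite gt_eqF.
have tH0 : 0 <= t * H by rewrite /t mulr_ge0 ?ltW // divr_gt0 // mulr_gt0 // exprn_gt0.
have tH : t * H <= eps / 48 by rewrite -tHH ler_peMr.
have eta1 : eta ^+ 2 <= 1.
  rewrite /eta expr_div_n ler_pdivrMr ?exprn_gt0 ?mulr_gt0 // mul1r.
  by apply: (le_trans eH); rewrite exprMn; nra.
have h1 : t * H * eta ^+ 2 <= eps / 48 by apply: le_trans tH; rewrite ler_piMr.
have h2 : t * H * b2 <= eps / 48 by apply: le_trans tH; rewrite ler_piMr.
rewrite (_ : _ + _ = 3 * (b * H) + 4 * (eta * H) + 4 * (t * H * eta ^+ 2) +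
  12 * (t * H * H) + 2 * (t * H * b2) + 2 * eps_PS * H); last by ring.
rewrite etaH tHH; lra.
Qed.

Lemma plug_in_probability (R : realType) (S A : finType) (K N M : nat)
    (P : S -> A -> S -> R) (r : S -> A -> R) (gamma : R)
    (anchors : 'I_K -> S * A) (lam : S -> A -> 'I_K -> R)
    (eps eps_PS L : R) (pihat : samples S K N -> policy S A) :
  let H := (1 - gamma)^-1 in
  let Pmix s a := mix (lam s a) (fun k => P (anchors k).1 (anchors k).2) in
  is_kernel P -> (forall s a, 0 <= r s a <= 1) -> 0 < gamma < 1 ->
  (forall s a, is_dist (lam s a)) ->
  0 < eps -> eps ^+ 2 <= H ->
  (forall omega, eps_optimal (emp_kernel lam omega) r gamma eps_PS (pihat omega)) ->
  ((0 < K)%N -> (0 < N)%N) -> ((0 < K)%N -> 0 <= L) -> 1152 * H ^+ 3 / eps ^+ 2 * L <= N%:R ->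
  8 * H ^+ 3 < M%:R ->
  1 - 2 * (K * (2 + M))%:R * expR (- L) <=
  prob_event P anchors (fun omega => forall s,
    Vstar Pmix r gamma s - Vpi Pmix r gamma (pihat omega) s <= eps + 2 * eps_PS * H).
Proof.
move=> H Pmix kP r01 gamma01 lamD eps0 epsH opt KN KL NL HM.
have /andP[g0 g1] := gamma01.
have H0 : 0 < H by rewrite invr_gt0 subr_gt0.
have H1 : 1 <= H by rewrite invf_ge1 ?subr_gt0 //; lra.
pose D k := P (anchors k).1 (anchors k).2.
have DD k : is_dist (D k) by exact: kernel_dist.
pose V := Vstar Pmix r gamma.
pose t := eps / (48 * H ^+ 2); pose t2 := (16 * H ^+ 2)^-1.
pose eta := eps / (32 * H).
have t0 : 0 < t by rewrite divr_gt0 // mulr_gt0 // exprn_gt0.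
have t20 : 0 < t2 by rewrite invr_gt0 mulr_gt0 // exprn_gt0.
have epsleH : eps <= H.
  rewrite -(ler_pXn2r (n := 2)) ?nnegrE ?(ltW eps0) ?(ltW H0) //.
  by apply: (le_trans epsH); rewrite expr2 ler_peMr // ltW.
(* The depth [n] does not enter the size of the union bound, so any large enough value will do. *)
have [n nH] : exists n, gamma ^+ n * H <= eps / (64 * H).
  have e64 : 0 < eps / (64 * H) / H by do 2 apply: divr_gt0 => //; apply: mulr_gt0.
  have gn : `|gamma| < 1 by rewrite gtr0_norm.
  have := cvg_expr gn => /cvgr0Pnorm_le /(_ _ e64) [n _ hn].
  exists n; rewrite -ler_pdivlMr //.
  by apply: le_trans (hn n (leqnn n)); rewrite ler_norm.
(* Radius [eps * H / 16] comes from the bound [crude]. The step, multiplied by [H], is half of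
   [eta]; truncation takes the other half. Diameter over step is [8 * H ^+ 3]. *)
pose w k (j : 'I_M) := avg (D k) V - eps * H / 16 + j%:R * (eps / (64 * H ^+ 2)).
pose F : finType := ('I_K * (bool + 'I_M))%type.
pose v (f : F) (x : samples S K N) : S -> R :=
  match f.2 with
  | inl true => V
  | inl false => fun s => V s ^+ 2
  | inr j => loo_value r gamma lam (emp_anchor R x) f.1 (w f.1 j) n
  end.
(* The square of [V] ranges up to [H ^+ 2], so it needs the scale [t2] to meet the smallness
   condition of [concentration]. *)
pose tt (f : F) := if f.2 is inl false then t2 else t.
have V_itv (x : samples S K N) s : 0 <= V s <= H.
  exact: (Vstar_itv r gamma lam r01 gamma01 lamD D (pihat x)).
have -> : (K * (2 + M))%N = #|F| by rewrite card_prod card_sum card_bool !card_ord.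
apply: (concentration R S A K N P anchors F fst v tt) => //.
- by case=> k _; apply: KN; apply: leq_ltn_trans (ltn_ord k).
- by case=> k [[]|j].
- case=> k [[]|j] x i s u //; rewrite /v /=; apply: loo_value_ext => k' kk'.
  exact: resample_emp_anchor.
- have tH : t * H <= 3^-1.
    rewrite (_ : t * H = eps / (48 * H)); last by rewrite /t; field; rewrite gt_eqF.
    by rewrite ler_pdivrMr ?mulr_gt0 //; lra.
  case=> k [[]|j] x s.
  + exact: (scaled_dev_le _ _ _ _ _ _ s (DD k) (V_itv x) (ltW t0) tH).
  + have V2 u : 0 <= V u ^+ 2 <= H ^+ 2.
      by case/andP: (V_itv x u) => ? ?; rewrite sqr_ge0 sqr_le_sqr.
    apply: (scaled_dev_le _ _ _ _ _ _ s (DD k) V2 (ltW t20)).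
    rewrite (_ : _ * _ = 16^-1); first by lra.
    by rewrite /t2; field; rewrite gt_eqF.
  + apply: (scaled_dev_le _ _ _ _ _ _ s (DD k) _ (ltW t0) tH) => u.
    exact: loo_value_itv.
move=> x dev.
have dev1 k : `|avg (emp_anchor R x k) V - avg (D k) V| <= t * var (D k) V + L / (N%:R * t).
  exact: (dev (k, inl true)).
have dev2 k := dev (k, inl false); rewrite /= /tt /= in dev2.
move=> s.
(* The state [s] and the action [pihat x s] carry coefficients summing to 1, which is impossible
   over an empty anchor set. *)
have K0 : (0 < K)%N.
  rewrite lt0n; apply/negP => /eqP K00; have := (lamD s (pihat x s)).2.
  rewrite big1 => [/eqP|[k kK]]; first by rewrite eq_sym oner_eq0.
  by exfalso; rewrite K00 in kK.
have N0 : 0 < N%:R :> R by rewrite ltr0n KN.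
have L0 : 0 <= L := KL K0.
have DD' k : is_dist (emp_anchor R x k) by apply: emp_anchor_dist; exact: KN.
(* [1152 = 24 * 48]: dividing by [t] yields exactly [eps / (24 * H)]. *)
have LN : L / N%:R <= eps ^+ 2 / (1152 * H ^+ 3).
  have q0 : 0 < eps ^+ 2 / (1152 * H ^+ 3).
    apply: divr_gt0; first exact: exprn_gt0.
    by apply: mulr_gt0; [rewrite ltr0n | exact: exprn_gt0].
  rewrite (ler_pdivrMr _ _ N0) -(ler_pdivrMl _ _ q0) invf_div; exact: NL.
have LN0 : 0 <= L / N%:R by rewrite divr_ge0 // ltW.
have b0 : 0 <= L / (N%:R * t) by rewrite divr_ge0 // ltW // mulr_gt0.
have b20 : 0 <= L / (N%:R * t2) by rewrite divr_ge0 // ltW // mulr_gt0.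
have b_le : L / (N%:R * t) <= eps / (24 * H).
  rewrite invfM mulrA ler_pdivrMr //; apply: (le_trans LN).
  by rewrite le_eqVlt; apply/orP; left; apply/eqP; rewrite /t; field; rewrite gt_eqF.
have b2_le : L / (N%:R * t2) <= 1.
  rewrite invfM mulrA ler_pdivrMr // mul1r; apply: (le_trans LN).
  have -> : eps ^+ 2 / (1152 * H ^+ 3) = t2 * (eps ^+ 2 / (72 * H)).
    by rewrite /t2; field; rewrite gt_eqF.
  by apply: ler_piMr; [exact: ltW | rewrite ler_pdivrMr ?mulr_gt0 //; lra].
have crude k : `|avg (emp_anchor R x k) V - avg (D k) V| <= eps / 16.
  apply: (le_trans (dev1 k)).
  have h1 : t * var (D k) V <= eps / 48.
    apply: (@le_trans _ _ (t * H ^+ 2)).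
      by rewrite ler_wpM2l ?(ltW t0) // var_le_sqr // => u; exact: V_itv.
    by rewrite le_eqVlt; apply/orP; left; apply/eqP; rewrite /t; field; rewrite gt_eqF.
  have h2 : eps / (24 * H) <= eps / 24.
    by rewrite ler_wpM2l ?(ltW eps0) // lef_pV2 ?posrE ?mulr_gt0 // ler_peMr.
  by have := le_trans b_le h2; lra.
apply: le_trans (gap_parameters R H eps eps_PS _ _ H1 eps0 epsH b_le b2_le).
have t8 : 8 * H * t <= 1.
  rewrite (_ : 8 * H * t = eps / (6 * H)); last by rewrite /t; field; rewrite gt_eqF.
  by rewrite ler_pdivrMr ?mulr_gt0 //; lra.
have eta0 : 0 <= eta by rewrite divr_ge0 ?(ltW eps0) // ltW // mulr_gt0.
apply: (plug_in_gap r gamma lam D (emp_anchor R x) (pihat x) r01 gamma01 lamD DD DD'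
  _ _ _ _ eps_PS (ltW t0) t8 eta0 b0 b20 (opt x) dev1 dev2).
move=> k; set V' := Vstar _ r gamma.
have ws := frozen_value_dev r gamma lam D _ (pihat x) r01 gamma01 lamD DD DD' _ k crude.
have [|||j hj] := grid_point R (avg (D k) V) (avg (emp_anchor R x k) V') (eps * H / 16)
   (eps / (64 * H ^+ 2)) M.
- by rewrite divr_gt0 // mulr_gt0 // exprn_gt0.
- by apply: (le_trans ws); rewrite -/H; lra.
- rewrite (_ : _ / _ = 8 * H ^+ 3) //; field; by rewrite !gt_eqF.
exists (v (k, inr j) x); split; last exact: (dev (k, inr j)).
move=> u; apply: (le_trans (loo_value_approx r gamma lam r01 gamma01 lamD _ (pihat x) DD' k _ n u)).
rewrite -/H -/V'.
have -> : eta = eps / (64 * H) + eps / (64 * H ^+ 2) * H.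
  by rewrite /eta; field; rewrite gt_eqF.
by apply: lerD => //; rewrite ler_wpM2r // ltW.
Qed.

(** * Misspecification, failure probability and the final bound *)

Lemma dist_l1_le2 (R : realType) (S : finType) (p q : S -> R) :
  is_dist p -> is_dist q -> \sum_s `|p s - q s| <= 2.
Proof.
move=> [p0 p1] [q0 q1]; rewrite (_ : 2 = \sum_s (p s + q s)); last first.
  by rewrite big_split /= p1 q1.
apply: ler_sum => s _; apply: le_trans (ler_normB _ _) _.
by rewrite !ger0_norm.
Qed.

Lemma tv_dist_l1 (R : realType) (S : finType) (p q : S -> R) :
  \sum_s `|p s - q s| = 2 * tv_dist p q.
Proof. by rewrite /tv_dist mulrA divff ?mul1r. Qed.

Lemma mix_misspecification (R : realType) (S A : finType) (K : nat)
    (P Pbar : S -> A -> S -> R) (phi : S -> A -> 'I_K -> R) (xi : R)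
    (anchors : 'I_K -> S * A) (lam : S -> A -> 'I_K -> R) :
  is_kernel P -> linear_repr Pbar phi -> 0 <= xi ->
  (forall s a, tv_dist (P s a) (Pbar s a) <= xi) ->
  anchor_assumption phi anchors lam ->
  forall s a, \sum_s' `|P s a s' -
    mix (lam s a) (fun k => P (anchors k).1 (anchors k).2) s'| <= 4 * Num.sqrt xi.
Proof.
move=> kP [psi Pbarpsi] xi0 tv [lam0 [lam1 lamphi]] s a.
have lamD : is_dist (lam s a) by split.
set D := fun k : 'I_K => P (anchors k).1 (anchors k).2.
have DD k : is_dist (D k) by exact: kernel_dist.
(* The natural bound is [4 * xi]. It is below [4 * Num.sqrt xi] when [xi <= 1]; beyond 1 the trivial
   l1 bound 2 suffices. *)
have [xi1|xi1] := leP xi 1; last first.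
  apply: (@le_trans _ _ 2).
    by apply: dist_l1_le2; [exact: kernel_dist | exact: is_dist_mix].
  have : 1 <= Num.sqrt xi by rewrite -sqrtr1 ler_sqrt // ltW.
  lra.
apply: (@le_trans _ _ (4 * xi)); last first.
  rewrite ler_wpM2l // -{1}(sqr_sqrtr xi0) expr2 ler_piMl ?sqrtr_ge0 //.
  by rewrite -sqrtr1 ler_sqrt.
(* Linearity in [phi] makes [Pbar] the exact mixture of its own anchor rows, so only two total
   variation errors remain: at [(s, a)] and at the anchors. *)
have barmix s' : Pbar s a s' = \sum_k lam s a k * Pbar (anchors k).1 (anchors k).2 s'.
  rewrite Pbarpsi; under eq_bigr => j _ do rewrite lamphi big_distrl /=.
  rewrite exchange_big; apply: eq_bigr => k _; rewrite Pbarpsi big_distrr /=.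
  by apply: eq_bigr => j _; rewrite mulrA.
apply: (@le_trans _ _ (\sum_s' `|P s a s' - Pbar s a s'| +
    \sum_s' \sum_k lam s a k * `|D k s' - Pbar (anchors k).1 (anchors k).2 s'|)).
  rewrite -big_split /=; apply: ler_sum => s' _.
  have -> : P s a s' - mix (lam s a) D s' = (P s a s' - Pbar s a s') -
     (\sum_k lam s a k * (D k s' - Pbar (anchors k).1 (anchors k).2 s')).
    under [in RHS]eq_bigr => k _ do rewrite mulrBr.
    by rewrite sumrB -barmix /mix; ring.
  apply: (le_trans (ler_normB _ _)); rewrite lerD2l.
  apply: (le_trans (ler_norm_sum _ _ _)); apply: ler_sum => k _.
  by rewrite normrM ger0_norm.
have h1 : \sum_s' `|P s a s' - Pbar s a s'| <= 2 * xi.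
  by rewrite tv_dist_l1 ler_wpM2l.
have h2 : \sum_s' \sum_k lam s a k * `|D k s' - Pbar (anchors k).1 (anchors k).2 s'| <= 2 * xi.
  rewrite exchange_big /=; apply: (@le_trans _ _ (avg (lam s a) (fun=> 2 * xi))).
    apply: ler_sum => k _; rewrite -big_distrr ler_wpM2l //.
    by rewrite tv_dist_l1 ler_wpM2l //; exact: tv.
  by rewrite avg_cst.
by lra.
Qed.

(** The grid has order [H ^+ 3] points, hence the factor 3 in the exponent: [X ^+ 3] dominates
    [c * K * H ^+ 3 / delta], while the union bound has at most [22 * K * H ^+ 3] terms. *)
Lemma failure_probability (R : realType) (c K M : nat) (H delta : R) :
  let X := c%:R * K%:R * H * delta^-1 in
  (22 < c)%N -> (0 < K)%N -> 1 <= H -> 0 < delta < 1 -> M%:R <= 8 * H ^+ 3 + 1 ->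
  1 < X /\ 2 * (K * (2 + M))%:R * expR (- (3 * ln X)) < delta.
Proof.
move=> X hc K0 H1 /andP[d0 d1] HM.
have c22 : 22 < c%:R :> R by rewrite ltr_nat.
have K1 : 1 <= K%:R :> R by rewrite ler1n.
have dX : delta * X = c%:R * K%:R * H by rewrite /X mulrC divfK // gt_eqF.
have KH1 : 1 <= K%:R * H by rewrite -[leLHS]mulr1 ler_pM.
have cH : c%:R * H <= X.
  rewrite /X ler_pdivlMr // -!mulrA ler_wpM2l // [leRHS]mulrC ler_wpM2l //; lra.
have HX : H <= X by apply: le_trans cH; rewrite ler_peMl //; lra.
have cX : c%:R <= X by apply: le_trans cH; rewrite ler_peMr //; lra.
have X1 : 1 < X by lra.
have X0 : 0 < X by lra.
split=> //; rewrite expRN expRM_natl lnK ?posrE // ltr_pdivrMr ?exprn_gt0 //.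
have H3 : 1 <= H ^+ 3 by exact: exprn_ege1.
have KH3 : 0 < K%:R * H ^+ 3 by apply: mulr_gt0; lra.
have h1 : (K * (2 + M))%:R <= 11 * (K%:R * H ^+ 3).
  rewrite natrM natrD mulrCA ler_wpM2l //; lra.
have h2 : 22 * (K%:R * H ^+ 3) < c%:R * (K%:R * H ^+ 3) by rewrite ltr_pM2r.
have h3 : c%:R * (K%:R * H ^+ 3) <= delta * X ^+ 3.
  have -> : delta * X ^+ 3 = c%:R * K%:R * H * X ^+ 2 by rewrite -dX; ring.
  have -> : c%:R * (K%:R * H ^+ 3) = c%:R * K%:R * H * H ^+ 2 by ring.
  rewrite ler_wpM2l //; first by rewrite !mulr_ge0 //; lra.
  by apply: sqr_le_sqr => //; lra.
lra.
Qed.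

Theorem theorem2 :
  exists c : nat, (0 < c)%N /\
  forall (R : realType) (S A : finType) (K : nat)
    (P : S -> A -> S -> R) (r : S -> A -> R) (gamma : R)
    (Pbar : S -> A -> S -> R) (phi : S -> A -> 'I_K -> R) (xi : R)
    (anchors : 'I_K -> S * A) (lam : S -> A -> 'I_K -> R)
    (delta eps eps_PS : R) (N : nat)
    (pihat : samples S K N -> policy S A),
  is_kernel P ->
  (forall s a, 0 <= r s a <= 1) ->
  0 < gamma < 1 ->
  is_kernel Pbar ->
  linear_repr Pbar phi ->
  0 <= xi ->
  (forall s a, tv_dist (P s a) (Pbar s a) <= xi) ->
  anchor_assumption phi anchors lam ->
  0 < delta < 1 ->
  0 < eps <= (Num.sqrt (1 - gamma))^-1 ->
  0 <= eps_PS ->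
  (forall omega, eps_optimal (emp_kernel lam omega) r gamma eps_PS (pihat omega)) ->
  N%:R >= c%:R * ln (c%:R * K%:R * (1 - gamma)^-1 * delta^-1)
            / ((1 - gamma) ^+ 3 * eps ^+ 2) ->
  prob_event P anchors
    (fun omega => forall s a,
       Qpi P r gamma (pihat omega) s a >=
       Qstar P r gamma s a - eps - 3 * eps_PS / (1 - gamma)
         - 16 * Num.sqrt xi / (1 - gamma) ^+ 2)
  > 1 - delta.
Proof.
(* 1152 is the constant of [plug_in_probability], and 3 comes from taking [L = 3 * ln X]. *)
have [c [hc c0]] : exists c : nat, (1152 * 3 <= c)%N /\ (0 < c)%N by exists (1152 * 3)%N.
exists c; split=> //.
move=> R S A K P r gamma Pbar phi xi anchors lam delta eps eps_PS N pihat.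
move=> kP r01 gamma01 _ lin xi0 tv anch d01 /andP[eps0 epsle] ePS0 opt hN.
have /andP[g0 g1] := gamma01; have g10 : 0 < 1 - gamma by rewrite subr_gt0.
pose H := (1 - gamma)^-1; have H0 : 0 < H by rewrite invr_gt0.
have H1 : 1 <= H by rewrite invf_ge1 //; lra.
have lamD s a : is_dist (lam s a) by case: anch => l0 [l1 _]; split.
have epsH : eps ^+ 2 <= H.
  apply: (le_trans (sqr_le_sqr _ _ (ltW eps0) epsle)).
  by rewrite exprVn sqr_sqrtr // ltW.
pose M := (Num.truncn (8 * H ^+ 3)).+1.
have M0 : 0 <= 8 * H ^+ 3 by rewrite mulr_ge0 // exprn_ge0 // ltW.
have /andP[Mlo Mhi] := truncn_itv M0.
have Mle : M%:R <= 8 * H ^+ 3 + 1 by rewrite /M -natr1 lerD2r.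
set X := c%:R * K%:R * H * delta^-1.
have c22 : (22 < c)%N by apply: leq_trans hc.
have lnX : 0 <= ln X.
  (* Without anchors [X] is 0, where [ln] takes the default value 0. *)
  case: (posnP K) => [K0|K0]; first by rewrite /X K0 mulr0 !mul0r ln0.
  by have [/ltW/ln_ge0] := failure_probability R c K M H delta c22 K0 H1 d01 Mle.
have hN' : 1152 * H ^+ 3 / eps ^+ 2 * (3 * ln X) <= N%:R.
  apply: le_trans hN; rewrite -/H -/X.
  have -> : c%:R * ln X / ((1 - gamma) ^+ 3 * eps ^+ 2) = c%:R * (H ^+ 3 / eps ^+ 2 * ln X).
    by rewrite /H; field; rewrite !gt_eqF.
  have -> : 1152 * H ^+ 3 / eps ^+ 2 * (3 * ln X) = (1152 * 3)%:R * (H ^+ 3 / eps ^+ 2 * ln X).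
    by rewrite natrM; ring.
  by rewrite ler_wpM2r ?ler_nat // mulr_ge0 // divr_ge0 // exprn_ge0 // ltW.
have KN : (0 < K)%N -> (0 < N)%N.
  move=> K0; have [X1 _] := failure_probability R c K M H delta c22 K0 H1 d01 Mle.
  rewrite -(ltr0n R); apply: lt_le_trans hN; rewrite -/H -/X.
  by rewrite divr_gt0 ?mulr_gt0 ?ltr0n ?ln_gt0 ?exprn_gt0.
have fail : 2 * (K * (2 + M))%:R * expR (- (3 * ln X)) < delta.
  case: (posnP K) => [->|K0]; first by rewrite mul0n mulr0 mul0r; case/andP: d01.
  by have [] := failure_probability R c K M H delta c22 K0 H1 d01 Mle.
have L0 : (0 < K)%N -> 0 <= 3 * ln X by move=> _; rewrite mulr_ge0.
have := plug_in_probability R S A K N M P r gamma anchors lam eps eps_PS _ pihat kP r01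
  gamma01 lamD eps0 epsH opt KN L0 hN' Mhi.
set E := fun _ => _; set E' := (X in prob_event _ _ X > _).
move=> hE; apply: (@lt_le_trans _ _ (1 - 2 * (K * (2 + M))%:R * expR (- (3 * ln X)))).
  by rewrite ltrD2l ltrN2.
apply: (le_trans hE); rewrite /prob_event big_mkcond [leRHS]big_mkcond.
apply: ler_sum => x _; case: asboolP => [Ex|_]; last first.
  case: asboolP => // _; apply: prodr_ge0 => i _; exact: kP.1.
suff E'x : E' x by rewrite asboolT.
move=> s a; rewrite /Qpi /Qstar.
pose Pmix u b := mix (lam u b) (fun k => P (anchors k).1 (anchors k).2).
have kPmix : is_kernel Pmix.
  by apply: mix_kernel => // k; exact: kernel_dist.
have mis := mix_misspecification R S A K P Pbar phi xi anchors lam kP lin xi0 tv anch.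
have mis' u b : \sum_s' `|Pmix u b s' - P u b s'| <= 4 * Num.sqrt xi.
  by under eq_bigr => s' _ do rewrite distrC.
have [pis [VE _]] := Vstar_optimal P r gamma kP r01 gamma01 (pihat x).
(* Two changes of kernel, one for the optimal policy [pis] of [P] and one for [pihat x], each cost
   [4 * Num.sqrt xi / (1 - gamma) ^+ 2]. *)
have gap u : Vstar P r gamma u - Vpi P r gamma (pihat x) u <=
    eps + 2 * eps_PS * H + 8 * Num.sqrt xi / (1 - gamma) ^+ 2.
  have h1 := Vpi_simulation R S A Pmix P r gamma _ pis kPmix kP r01 gamma01 mis u.
  have h2 := Vpi_simulation R S A P Pmix r gamma _ (pihat x) kP kPmix r01 gamma01 mis' u.
  have h3 := Vpi_le_Vstar Pmix r gamma pis u.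
  by have := Ex u; rewrite VE -/Pmix -/H; lra.
(* The action values differ by [gamma] times an average of the value gap. The constants 2 and 8
   obtained so far lie below the claimed 3 and 16. *)
have := avg_le (P s a) (fun u => Vstar P r gamma u - Vpi P r gamma (pihat x) u) _
  (kernel_dist _ _ _ P s a kP) gap.
set B := (X in _ <= X); rewrite avgB => /(ler_wpM2l (ltW g0)) hQ.
have sx : 0 <= Num.sqrt xi / (1 - gamma) ^+ 2.
  by rewrite divr_ge0 ?sqrtr_ge0 // exprn_ge0 // ltW.
have B0 : 0 <= B.
  by rewrite !addr_ge0 ?(ltW eps0) //; [rewrite !mulr_ge0 // ltW | rewrite -mulrA mulr_ge0].
have gB : gamma * B <= B by rewrite ler_piMl // ltW.
have ePSH : 0 <= eps_PS * H by rewrite mulr_ge0 // ltW.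
rewrite -/(avg (P s a) (Vstar P r gamma)) -/(avg (P s a) (Vpi P r gamma (pihat x))).
move: hQ gB; rewrite /B -!mulrA -/H; lra.
Qed.
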